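(* Let $r>1$, let $w$ be a weight on $\mathbb{R}^n$ and let $\mathcal S$ be a sparse family. For $f\ge0$ set $$\mathcal A_{r,\mathcal S}(f)(x)=\sum_{Q\in\mathcal S}\langle f^r\rangle_Q^{\frac1r}\chi_Q(x).$$ Let $p>r$ and let $A$ be a Young function such that $\bar A\in B_{p'}$. Then $$\|\mathcal A_{r,\mathcal S}(f)\|_{L^p(w)}\le (c_np')^{\frac{r(p-1)}{p-r}}\Big(\frac pr\Big)'\,\|M_{\bar A}\|_{L^{p'}}\,\|f\|_{L^p(M_{A_p}w)},$$ where $A_p(t):=A(t^{1/p})$ and $c_n$ is a constant depending only on $n$ (and on the sparseness parameter of $\mathcal S$).
   Context: A weight is a nonnegative locally integrable function $w$ on $\mathbb{R}^n$; $\|f\|_{L^p(w)}=(\int|f|^pw)^{1/p}$; $s'$ denotes the conjugate exponent of $s$, so $(p/r)'=\frac{p}{p-r}$; $\langle f\rangle_Q=\frac1{|Q|}\int_Qf$. A dyadic lattice $\mathcal D$ is a collection of cubes in $\mathbb{R}^n$ such that every dyadic descendant of a cube in $\mathcal D$ is in $\mathcal D$, any two cubes in $\mathcal D$ have a common ancestor in $\mathcal D$ (a cube of $\mathcal D$ of which both are dyadic descendants), and every compact set is contained in a cube of $\mathcal D$. A family $\mathcal S\subset\mathcal D$ is $\eta$-sparse ($0<\eta<1$) if for each $Q\in\mathcal S$ there is a measurable $E_Q\subset Q$ with $\eta|Q|\le|E_Q|$ and the sets $E_Q$ are pairwise disjoint; sparse means $\eta$-sparse for some fixed $\eta$. A Young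 function is a convex, strictly increasing $A:[0,\infty)\to[0,\infty)$ with $A(0)=0$ and $A(t)\to\infty$ as $t\to\infty$. Its complementary function is $\bar A(s)=\sup_{t>0}\{st-A(t)\}$. Standing assumption: all Young functions considered satisfy $\lim_{t\to\infty}A(t)/t=\infty$ and $\lim_{t\to0}A(t)/t=0$, so $\bar A$ is again a Young function. A Young function $\Phi$ is doubling if $\Phi(2t)\le C\Phi(t)$ for some $C$; a doubling Young function $\Phi$ satisfies $\Phi\in B_{p'}$ if $\int_c^\infty\frac{\Phi(t)}{t^{p'}}\frac{dt}t<\infty$ for some $c>0$. For a positive function $\Phi$ and a cube $Q$, $\|f\|_{\Phi,Q}=\inf\{\lambda>0:\frac1{|Q|}\int_Q\Phi(|f(x)|/\lambda)\,dx\le1\}$, and $M_\Phi f(x)=\sup_{Q\ni x}\|f\|_{\Phi,Q}$ (supremum over cubes). $\|M_{\bar A}\|_{L^{p'}}$ is the operator norm of $M_{\bar A}$ on unweighted $L^{p'}(\mathbb{R}^n)$. *)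

(* Defs.v *)
From HB Require Import structures.
From mathcomp Require Import all_boot all_order all_algebra.
From mathcomp Require Import all_classical all_reals all_analysis.

Set Implicit Arguments.
Unset Strict Implicit.
Unset Printing Implicit Defensive.

Import Order.TTheory GRing.Theory Num.Theory.
Import numFieldNormedType.Exports.

Local Open Scope classical_set_scope.
Local Open Scope ring_scope.

Definition rV_display : measure_display.
Proof. exact. Qed.

Section measurable_rV.
Variables (R : realType) (n : nat).

Let coord (i : 'I_n) (x : 'rV[R]_n) : R := x ord0 i.

Let rV_set0 : g_sigma_preimage coord set0.
Proof. exact: sigma_algebra0. Qed.

Let rV_setC A : g_sigma_preimage coord A -> g_sigma_preimage coord (~` A).
Proof. exact: sigma_algebraC. Qed.

Let rV_bigcup (F : _^nat) : (forall i, g_sigma_preimage coord (F i)) ->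
  g_sigma_preimage coord (\bigcup_i (F i)).
Proof. exact: sigma_algebra_bigcup. Qed.

(* The product (i.e., Borel) sigma-algebra of R^n. *)
HB.instance Definition _ := @isMeasurable.Build rV_display
  'rV[R]_n (g_sigma_preimage coord) rV_set0 rV_setC rV_bigcup.

Lemma measurable_coord (i : 'I_n) :
  measurable_fun [set: 'rV[R]_n] (fun x : 'rV[R]_n => x ord0 i).
Proof.
move=> _ Y mY; rewrite setTI; apply: sub_sigma_algebra => /=.
rewrite -bigcup_seq/=; exists i => /=; first by rewrite mem_index_enum.
by exists Y => //; rewrite setTI.
Qed.

Lemma measurable_fun_rV d (T : measurableType d) (f : T -> 'rV[R]_n) :
  (forall i, measurable_fun [set: T] (fun x => f x ord0 i)) ->
  measurable_fun [set: T] f.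
Proof.
move=> mf _ A mA; rewrite setTI.
suff: g_sigma_preimage coord `<=` [set B | measurable (f @^-1` B)] by apply.
apply: smallest_sub.
  split => [|B|F] /=.
  - by rewrite preimage_set0.
  - by move=> mB; rewrite setTD preimage_setC; exact: measurableC.
  - by move=> mF; rewrite preimage_bigcup; exact: bigcup_measurable.
rewrite -bigcup_seq => B [i _ [C mC <-]] /=.
by rewrite setTI; have := mf i measurableT _ mC; rewrite setTI.
Qed.

End measurable_rV.

Definition rV_cons (R : realType) n (yx : 'rV[R]_n * R) : 'rV[R]_n.+1 :=
  \row_i oapp (fun j => yx.1 ord0 j) yx.2 (unlift ord0 i).

Lemma measurable_rV_cons (R : realType) n :
  measurable_fun [set: 'rV[R]_n * R] (@rV_cons R n).
Proof.
apply: measurable_fun_rV => i.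
under eq_fun do rewrite mxE.
case: unliftP => [j _|_] /=.
  exact: measurableT_comp (measurable_coord j) measurable_fst.
exact: measurable_snd.
Qed.

Section product_with_line.
Variables (R : realType) (n : nat).
Variable mu : {measure set 'rV[R]_n -> \bar R}.
Local Open Scope ereal_scope.

Definition product_with_line : set 'rV[R]_n.+1 -> \bar R :=
  pushforward (mu \x lebesgue_measure) (@rV_cons R n).

Let mcons := @measurable_rV_cons R n.

Let product_with_line0 : product_with_line set0 = 0.
Proof. exact: (@measure0 _ _ _ [the measure _ _ of pushforward _ _]). Qed.

Let product_with_line_ge0 A : 0 <= product_with_line A.
Proof. exact: measure_ge0. Qed.

Let product_with_line_sigma_additive : semi_sigma_additive product_with_line.
Proof. exact: measure_semi_sigma_additive. Qed.

HB.instance Definition _ := isMeasure.Build _ _ _ product_with_line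
  product_with_line0 product_with_line_ge0 product_with_line_sigma_additive.

End product_with_line.

(* The n-fold product of the one-dimensional Lebesgue measure. *)
Fixpoint borel_lebesgue (R : realType) (n : nat) :
    {measure set 'rV[R]_n -> \bar R} :=
  match n with
  | 0%N => dirac (0 : 'rV[R]_0)
  | m.+1 => product_with_line (borel_lebesgue R m)
  end.

(* R^n with its Lebesgue sigma-algebra, the completion of the Borel one. *)
Definition Rn (R : realType) (n : nat) : Type :=
  caratheodory_type (mu_ext (borel_lebesgue R n)).

HB.instance Definition _ (R : realType) (n : nat) :=
  Measurable.copy (Rn R n) (caratheodory_type (mu_ext (borel_lebesgue R n))).

Definition lebesgue (R : realType) (n : nat) :
    {measure set (Rn R n) -> \bar R} :=
  @completed_measure_extension _ _ _ (borel_lebesgue R n).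

Section definitions.
Variables (R : realType) (n : nat).
Local Notation E := (Rn R n).
Local Notation leb := (lebesgue R n).

Definition weight (w : E -> R) : Prop :=
  [/\ forall x, 0 <= w x, measurable_fun [set: E] w &
      forall K : set 'rV[R]_n, compact K ->
        (\int[leb]_(x in K) (w x)%:E < +oo)%E].

(* The norm of L^p(v); the density v may take the value +oo. *)
Definition Lp_norm (p : R) (v f : E -> \bar R) : \bar R :=
  (poweR (\int[leb]_x (poweR `|f x| p * v x)) p^-1)%E.

Definition conj_exp (s : R) : R := s / (s - 1).

(* A cube is given by its lower corner and its side length.  Cubes are
   half-open, so that bisecting the sides of a cube partitions it. *)
Definition cube : Type := ('rV[R]_n * {posnum R})%type.

Definition cube_set (Q : cube) : set E :=
  [set x : 'rV[R]_n | forall i,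
    Q.1 ord0 i <= x ord0 i < Q.1 ord0 i + Q.2%:num].

(* P is one of the 2^(kn) congruent cubes obtained from Q by k bisections
   of its sides, for some k. *)
Definition dyadic_descendant (Q P : cube) : Prop :=
  exists (k : nat) (m : 'I_n -> 'I_(2 ^ k)),
    P.2%:num = Q.2%:num / 2 ^+ k /\
    forall i, P.1 ord0 i = Q.1 ord0 i + (m i)%:R * (Q.2%:num / 2 ^+ k).

Definition dyadic_lattice (D : set cube) : Prop :=
  [/\ forall Q P, D Q -> dyadic_descendant Q P -> D P,
      forall P1 P2, D P1 -> D P2 -> exists Q,
        [/\ D Q, dyadic_descendant Q P1 & dyadic_descendant Q P2] &
      forall K : set 'rV[R]_n, compact K ->
        exists2 Q, D Q & K `<=` cube_set Q].

Definition sparse (eta : R) (S : set cube) : Prop :=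
  exists F : cube -> set E,
    (forall Q, S Q ->
      [/\ measurable (F Q), F Q `<=` cube_set Q &
          (eta%:E * leb (cube_set Q) <= leb (F Q))%E]) /\
    trivIset S F.

Definition average (Q : cube) (g : E -> \bar R) : \bar R :=
  ((fine (leb (cube_set Q)))^-1%:E * \int[leb]_(x in cube_set Q) g x)%E.

Definition sparse_op (r : R) (S : set cube) (f : E -> R) (x : E) : \bar R :=
  (\esum_(Q in S)
     (poweR (average Q (fun y => (f y `^ r)%:E)) r^-1 *
      (\1_(cube_set Q) x)%:E))%E.

(* Only the values on [0, +oo[ matter. *)
Definition young (A : R -> R) : Prop :=
  [/\ convex_function (`[0, +oo[%classic : set R^o) (A : R^o -> R^o),
      {in `[0, +oo[ &, {homo A : s t / s < t}},
      A 0 = 0 &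
      A t @[t --> +oo] --> +oo].

(* Standing growth assumptions, which make [complementary A] a Young function. *)
Definition proper_young (A : R -> R) : Prop :=
  [/\ young A, A t / t @[t --> +oo] --> +oo & A t / t @[t --> 0^'+] --> (0 : R)].

(* The supremum is finite under the standing growth assumptions. *)
Definition complementary (A : R -> R) (s : R) : R :=
  sup [set s * t - A t | t in [set t | 0 < t]].

Definition doubling (Phi : R -> R) : Prop :=
  exists C : R, forall t, 0 <= t -> Phi (2 * t) <= C * Phi t.

Definition Bclass (q : R) (Phi : R -> R) : Prop :=
  [/\ young Phi, doubling Phi &
      exists2 c : R, 0 < c &
        (\int[lebesgue_measure]_(t in `[c, +oo[) (Phi t / t `^ q / t)%:E < +oo)%E].

Definition luxemburg (Phi : R -> R) (f : E -> R) (Q : cube) : \bar R :=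
  ereal_inf [set l%:E | l in
    [set l : R | 0 < l /\ (average Q (fun x => (Phi (`|f x| / l))%:E) <= 1)%E]].

Definition maximal (Phi : R -> R) (f : E -> R) (x : E) : \bar R :=
  ereal_sup [set luxemburg Phi f Q | Q in [set Q | cube_set Q x]].

Definition maximal_norm (Phi : R -> R) (q : R) : \bar R :=
  ereal_sup [set Lnorm leb q%:E (maximal Phi f) | f in
    [set f : E -> R | measurable_fun [set: E] f /\
                      (Lnorm leb q%:E (EFin \o f) <= 1)%E]].

End definitions.

Lemma measurable_box (R : realType) n (a : 'rV[R]_n) (l : R) :
  measurable [set x : 'rV[R]_n | forall i, a ord0 i <= x ord0 i < a ord0 i + l].
Proof.
have -> : [set x : 'rV[R]_n | forall i, a ord0 i <= x ord0 i < a ord0 i + l] =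
  \bigcap_(i in [set: 'I_n])
    ((fun x : 'rV[R]_n => x ord0 i) @^-1` `[a ord0 i, a ord0 i + l[).
  apply/seteqP; split => x /= H i; first by move=> _ /=; rewrite in_itv /=.
  by have := H i I; rewrite /= in_itv.
apply: fin_bigcap_measurable => // i _.
by rewrite -[X in measurable X]setTI; exact: (@measurable_coord R n i).
Qed.

Lemma borel_lebesgue_box (R : realType) n (a : 'rV[R]_n) (l : R) : 0 < l ->
  borel_lebesgue R n
    [set x : 'rV[R]_n | forall i, a ord0 i <= x ord0 i < a ord0 i + l] =
  (l ^+ n)%:E.
Proof.
move=> l0; elim: n a => [|n IH] a.
  rewrite /= diracE expr0 mem_set//= => -[]//.
rewrite /= /product_with_line /pushforward.
set X := _ @^-1` _.
pose b : 'rV[R]_n := \row_j a ord0 (lift ord0 j).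
have -> : X =
    [set x : 'rV[R]_n | forall i, b ord0 i <= x ord0 i < b ord0 i + l] `*`
    `[a ord0 ord0, a ord0 ord0 + l[.
  apply/seteqP; split => -[x y] /=.
    move=> H; split.
      by move=> i; have := H (lift ord0 i); rewrite !mxE liftK.
    by have := H ord0; rewrite !mxE unlift_none /= in_itv.
  move=> [H1 H2] i; rewrite !mxE; case: unliftP => [j ->|->] /=.
    by have := H1 j; rewrite !mxE.
  by move: H2; rewrite in_itv.
rewrite product_measure1E//; last exact: measurable_box.
rewrite IH.
transitivity ((l ^+ n)%:E * l%:E)%E; last by rewrite -EFinM exprSr.
congr (_ * _)%E.
apply: eq_trans (lebesgue_measure_itv `[a ord0 ord0, a ord0 ord0 + l[) _.
by rewrite /= lte_fin ltrDl l0 -EFinB addrAC subrr add0r.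
Qed.

Lemma lebesgue_cube (R : realType) n (Q : cube R n) :
  lebesgue R n (cube_set Q) = (Q.2%:num ^+ n)%:E.
Proof.
rewrite -(borel_lebesgue_box Q.1)//.
by apply: measurable_mu_extE; exact: measurable_box.
Qed.

(* Main.v *)
(* Write v = M_{A_p} w, a_Q = ||w||_{A_p,Q} and c_Q = <f^r>_Q, and test
   A_{r,S} f against g with ||g||_{L^{p'}(w)} = 1; put h = g w^{1/p'}. The
   generalized Hoelder inequality for the pair (A, complementary A) gives
     int_Q g w <= 2 |Q| ||h||_{complementary A, Q} a_Q^{1/p},
   and |Q| <= |E_Q| / eta. Hoelder's inequality for the sums over Q with weights
   |E_Q| then leaves two factors. The factor with ||h||_{complementary A, Q} is at
   most the norm of the maximal operator, since the E_Q are disjoint. As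
   a_Q <= v on Q, the factor with c_Q^{1/r} a_Q^{1/p} is estimated by the dyadic
   Carleson embedding theorem in L^{p/r} applied to f^r v^{r/p}; it costs at most
   2 (p/r)'. Hence the constant 4 / eta * (p/r)', which is below the stated one
   because the exponent r (p - 1) / (p - r) is at least 1. *)
Require Import Defs.
From HB Require Import structures.
From mathcomp Require Import all_boot all_order all_algebra.
From mathcomp Require Import all_classical all_reals all_analysis.
From mathcomp Require Import measurable_realfun ring lra.

Set Implicit Arguments.
Unset Strict Implicit.
Unset Printing Implicit Defensive.

Import Order.TTheory GRing.Theory Num.Theory.
Import numFieldNormedType.Exports.

Local Open Scope classical_set_scope.
Local Open Scope ring_scope.

(** Three obstacles shape the proof. First, v is a supremum over uncountably many cubes whose
    measurability is never established: integrals involving it are compared by monotonicity only,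
    and in the Carleson embedding it is replaced by a finite maximum [u] with a_Q <= u on Q and u <=
    v. This calls for finite lists of cubes. So does duality, which needs the left-hand side to be
    finite beforehand; for a finite list this follows from local integrability of w. Monotone
    convergence recovers the whole sum. Second, a_Q and c_Q may be 0 or infinite. Cubes where one of
    them is 0 contribute nothing, up to a null set; on the others a finite right-hand side forces
    both to be finite, so that the core estimate deals with real numbers. Third, the embedding is
    proved without a dyadic maximal function, by summing a truncated weak-type bound over the
    levels. It gives the constant 2^(p/r) (p/r)', whose p-th root is rounded up to 2 (p/r)'. *)

Lemma measurable_fun_powR d (T : measurableType d) (R : realType) (D : set T)
    (f : T -> R) (p : R) :
  measurable_fun D f -> measurable_fun D (fun x => f x `^ p).
Proof. exact: (measurableT_comp (measurable_powR _)). Qed.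

(** * Integrals, and unions of nested sets *)

Section integral_lemmas.
Context d (T : measurableType d) (R : realType) (mu : {measure set T -> \bar R}).
Local Open Scope ereal_scope.

(* Unlike [ge0_le_integral], no measurability is required; this is what allows
   maximal functions (suprema over uncountably many cubes) as upper bounds. *)
Lemma ge0_le_integral_any (D : set T) (f g : T -> \bar R) :
  (forall x, D x -> 0 <= f x) -> (forall x, D x -> f x <= g x) ->
  \int[mu]_(x in D) f x <= \int[mu]_(x in D) g x.
Proof.
move=> f0 fg.
have g0 x : D x -> 0 <= g x by move=> Dx; exact: le_trans (f0 _ Dx) (fg _ Dx).
rewrite !ge0_integralE//; apply: le_ereal_sup => _ [h /= hf <-].
by exists h => //= x; apply: le_trans (hf x) _; exact: lee_restrict.
Qed.

(** The distinct sets maximal for inclusion are disjoint and have the same union, so the hypotheses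
    on them add up. The induction either drops a set contained in a later one, or keeps [B i] and
    drops every set meeting it, each of these lying inside [B i]. *)
Lemma nested_union_weak_type (I : choiceType) (B : I -> set T) (H : T -> R) (t : R)
    (s : seq I) :
  measurable_fun [set: T] H -> (forall x, (0 <= H x)%R) -> (0 <= t)%R ->
  (forall i, i \in s -> measurable (B i)) ->
  (forall i j, i \in s -> j \in s ->
     [\/ B i `<=` B j, B j `<=` B i | B i `&` B j = set0]) ->
  (forall i, i \in s -> t%:E * mu (B i) <= \int[mu]_(x in B i) (H x)%:E) ->
  t%:E * mu (\big[setU/set0]_(i <- s) B i) <=
  \int[mu]_(x in \big[setU/set0]_(i <- s) B i) (H x)%:E.
Proof.
move=> mH H0 t0.
have [n] := ubnP (size s); elim: n s => // n IH [|i s] /=.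
  by rewrite big_nil measure0 mule0 integral_set0.
rewrite ltnS => ssn mB nest wB.
have [[j js Bij]|nB] := pselect (exists2 j, j \in s & B i `<=` B j).
  have -> : \big[setU/set0]_(k <- (i :: s)) B k = \big[setU/set0]_(k <- s) B k.
    rewrite big_cons setUidr// => x /Bij Bjx.
    by rewrite -bigcup_seq; exists j.
  apply: IH => //.
  - by move=> k ks; apply: mB; rewrite inE ks orbT.
  - by move=> k l ks ls; apply: nest; rewrite inE ?ks ?ls orbT.
  - by move=> k ks; apply: wB; rewrite inE ks orbT.
pose s' := [seq k <- s | `[< B i `&` B k = set0 >]].
have s'P k : k \in s' -> k \in s /\ B i `&` B k = set0.
  by rewrite mem_filter => /andP[/asboolP].
have -> : \big[setU/set0]_(k <- (i :: s)) B k =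
    B i `|` \big[setU/set0]_(k <- s') B k.
  rewrite big_cons; apply/seteqP; split => x [Bx|]; try by left.
    rewrite -bigcup_seq => -[k /= ks Bkx].
    have [||Bik|Bki|Bik0] := nest i k; rewrite ?inE ?eqxx ?ks ?orbT//.
    - by exfalso; apply: nB; exists k.
    - by left; exact: Bki.
    - right; rewrite -bigcup_seq; exists k => //=.
      by rewrite mem_filter ks andbT; apply/asboolP.
  by rewrite -!bigcup_seq => -[k /= /s'P[ks _] Bkx]; right; exists k.
have mU : measurable (\big[setU/set0]_(k <- s') B k).
  rewrite -bigcup_seq; apply: fin_bigcup_measurable => // k /= /s'P[ks _].
  by apply: mB; rewrite inE ks orbT.
have mi : measurable (B i) by apply: mB; rewrite mem_head.
have dis : B i `&` \big[setU/set0]_(k <- s') B k = set0.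
  rewrite -bigcup_seq; apply/seteqP; split=> // x [Bix [k /= /s'P[_ ik0] Bkx]].
  by have : (B i `&` B k) x by []; rewrite ik0.
rewrite measureU// ge0_integral_setU//; last 3 first.
- by apply/measurable_EFinP; exact: measurable_funTS.
- by move=> x _; rewrite lee_fin.
- exact/disj_set2P.
rewrite ge0_muleDr//; apply: leeD; first by apply: wB; rewrite mem_head.
apply: IH => //.
- by rewrite (leq_ltn_trans _ ssn)// size_filter count_size.
- by move=> k /s'P[ks _]; apply: mB; rewrite inE ks orbT.
- by move=> k l /s'P[ks _] /s'P[ls _]; apply: nest; rewrite inE ?ks ?ls orbT.
- by move=> k /s'P[ks _]; apply: wB; rewrite inE ks orbT.
Qed.


Lemma sum_measure_le_union (I : choiceType) (E B : I -> set T) (s : seq I) :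
  uniq s -> trivIset [set` s] E ->
  (forall i, i \in s -> measurable (E i)) ->
  (forall i, i \in s -> measurable (B i)) ->
  (forall i, i \in s -> E i `<=` B i) ->
  \sum_(i <- s) mu (E i) <= mu (\big[setU/set0]_(i <- s) B i).
Proof.
move=> us tE mE mB EB.
have mUB : measurable (\big[setU/set0]_(i <- s) B i).
  by rewrite -bigcup_seq; exact: fin_bigcup_measurable.
have mUE : measurable (\big[setU/set0]_(i <- s) E i).
  by rewrite -bigcup_seq; exact: fin_bigcup_measurable.
have <- : mu (\big[setU/set0]_(i <- s) E i) = \sum_(i <- s) mu (E i).
  rewrite -bigcup_seq measure_fin_bigcup//.
  exact/esym/fsbig_seq.
apply: le_measure; rewrite ?inE// -!bigcup_seq => x [i /= si Ex].
by exists i => //; exact: EB.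
Qed.

End integral_lemmas.

(** Young's inequality for [a * b^(q - 1)] with exponents [q] and [q / (q - 1)], rearranged. It is
    the discrete form of [d(t^q) = q / (q - 1) * t * d(t^(q - 1))]: a jump of [t^q] becomes a jump
    of [t^(q - 1)] times [t], to which a weak-type bound applies. *)
Lemma powR_sub_le (R : realType) (q a b : R) : 1 < q -> 0 <= a -> 0 <= b ->
  a `^ q - b `^ q <= q / (q - 1) * (a * (a `^ (q - 1) - b `^ (q - 1))).
Proof.
move=> q1 a0 b0; have q0 : 0 < q by lra.
have q10 : 0 < q - 1 by lra.
have q10' : 0 < q / (q - 1) by rewrite divr_gt0.
have H := @conjugate_powR R a (b `^ (q - 1)) q (q / (q - 1)) a0 (powR_ge0 _ _) q0 q10'.
have /H {}H : q^-1 + (q / (q - 1))^-1 = 1 by field; apply/andP; split; lra.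
rewrite -powRrM (_ : (q - 1) * (q / (q - 1)) = q) in H; last by field; lra.
rewrite mulrBr mulr_powRB1//.
rewrite -ler_pdivrMl// -subr_ge0.
rewrite -subr_ge0 in H.
apply: le_trans H _.
by rewrite le_eqVlt; apply/orP; left; apply/eqP; field; lra.
Qed.

Lemma seq_argmin (R : realType) (I : eqType) (m : I -> R) (s : seq I) : s != [::] ->
  exists2 i, i \in s & forall j, j \in s -> m i <= m j.
Proof.
elim: s => // i [|j s] IH _.
  by exists i; rewrite ?mem_head// => j; rewrite inE => /eqP->.
have [//|k ks kmin] := IH.
have [ik|ki] := leP (m i) (m k).
  exists i; rewrite ?mem_head// => l; rewrite inE => /predU1P[->//|ls].
  exact: le_trans ik (kmin _ ls).
exists k; first by rewrite inE ks orbT.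
by move=> l; rewrite inE => /predU1P[->|/kmin//]; exact: ltW.
Qed.

(** * The Carleson embedding for nested families *)

Section carleson_embedding.
Context d (T : measurableType d) (R : realType) (mu : {measure set T -> \bar R}).
Variables (I : choiceType) (B E : I -> set T) (m : I -> R) (H : T -> R) (q : R).
Hypotheses (q1 : 1 < q) (mH : measurable_fun [set: T] H)
  (H0 : forall x, 0 <= H x).

(* [m i] may be any lower bound of the average of [H] over [B i]. *)
Definition carleson_family (s : seq I) :=
  [/\ uniq s, trivIset [set` s] E,
      forall i, i \in s -> [/\ measurable (E i), measurable (B i), E i `<=` B i,
        (mu (B i) < +oo)%E & ((m i)%:E * mu (B i) <= \int[mu]_(x in B i) (H x)%:E)%E] &
      forall i j, i \in s -> j \in s ->
        [\/ B i `<=` B j, B j `<=` B i | B i `&` B j = set0]].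

Lemma carleson_family_sub (s s' : seq I) : uniq s' -> {subset s' <= s} ->
  carleson_family s -> carleson_family s'.
Proof.
move=> us' s's [us tE ms nest]; split => //.
- by apply: sub_trivIset tE => i /=; exact: s's.
- by move=> i /s's/ms.
- by move=> i j /s's ? /s's; exact: nest.
Qed.

Local Open Scope ereal_scope.

(* Truncation: the values of [H] below [t / 2] contribute at most half of
   [t * mu U], where [U] is the union of the [B i]. *)
Lemma weak_type_halved (t : R) (s : seq I) : (0 <= t)%R -> carleson_family s ->
  (forall i, i \in s -> (t <= m i)%R) ->
  t%:E * \sum_(i <- s) mu (E i) <=
  2%:E * \int[mu]_x (if (t < 2 * H x)%R then H x else 0)%:E.
Proof.
move=> t0 [us tE ms nest] tm.
set U := \big[setU/set0]_(i <- s) B i.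
set J := \int[mu]_x _.
have mE i : i \in s -> measurable (E i) by move=> /ms[].
have mB i : i \in s -> measurable (B i) by move=> /ms[].
have mU : measurable U by rewrite /U -bigcup_seq; exact: fin_bigcup_measurable.
have tU : t%:E * mu U <= \int[mu]_(x in U) (H x)%:E.
  apply: nested_union_weak_type => // i si.
  have [_ _ _ _] := ms _ si; apply: le_trans.
  by rewrite lee_wpmul2r// lee_fin tm.
(* The term [t / 2 * mu U] of [HJ] can be absorbed into [t * mu U] only if it is finite. *)
have Uoo : mu U < +oo.
  apply: (@le_lt_trans _ _ (\sum_(i <- s) mu (B i))).
    rewrite /U => {tE us mE tU mU U nest tm}.
    elim: s ms mB => [|i s IH] ms mB; first by rewrite !big_nil measure0.
    rewrite !big_cons; apply: le_trans (measureU2 _ _ _) _ => //.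
    - by apply: mB; rewrite mem_head.
    - rewrite -bigcup_seq; apply: fin_bigcup_measurable => // k /= ks.
      by apply: mB; rewrite inE ks orbT.
    - by rewrite leeD2l// IH// => k ks; [apply: ms|apply: mB]; rewrite inE ks orbT.
  by rewrite big_seq; apply: lte_sum_pinfty => i /ms[].
have Ufin : mu U \is a fin_num by rewrite ge0_fin_numE.
have mK : measurable_fun [set: T] (fun x => (if (t < 2 * H x)%R then H x else 0)%:E).
  apply/measurable_EFinP; apply: measurable_fun_ifT => //.
  apply: measurable_fun_ltr => //; exact: measurable_funM.
have K0 x : 0 <= (if (t < 2 * H x)%R then H x else 0)%:E by case: ifPn; rewrite lee_fin.
have HJ : \int[mu]_(x in U) (H x)%:E <= J + (t / 2)%:E * mu U.
  apply: (@le_trans _ _ (\int[mu]_(x in U)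
    ((if (t < 2 * H x)%R then H x else 0)%:E + (t / 2)%:E))).
    apply: ge0_le_integral_any => x _; first by rewrite lee_fin.
    by rewrite -EFinD lee_fin; case: ltP; have := H0 x; lra.
  rewrite ge0_integralD//; last 2 first.
  - exact: measurable_funTS.
  - by move=> x _; rewrite lee_fin; lra.
  rewrite integral_cst//; apply: leeD => //.
  exact: ge0_subset_integral.
have tJ : (t / 2)%:E * mu U <= J.
  have := le_trans tU HJ.
  rewrite -(fineK Ufin) -!EFinM -leeBlDr//.
  by rewrite -EFinB; apply: le_trans; rewrite lee_fin; lra.
apply: (@le_trans _ _ (t%:E * mu U)).
  by rewrite lee_wpmul2l//; apply: sum_measure_le_union => // i /ms[].
rewrite [in leLHS](_ : t = 2 * (t / 2))%R; last by field.
by rewrite EFinM -muleA lee_wpmul2l.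
Qed.

(* Summation by parts over the levels [m i]: the induction removes an index of
   minimal [m i] and raises the base level [t] to that minimum. *)
Lemma carleson_embedding_above (t : R) (s : seq I) : (0 <= t)%R -> carleson_family s ->
  (forall i, i \in s -> (t <= m i)%R) ->
  \sum_(i <- s) (m i `^ q - t `^ q)%:E * mu (E i) <=
  (2 * (q / (q - 1)))%:E *
  \int[mu]_x (H x * Num.max 0 ((2 * H x) `^ (q - 1) - t `^ (q - 1)))%:E.
Proof.
have hq := q1; have q0 : (0 < q - 1)%R by lra.
have c0 : (0 <= 2 * (q / (q - 1)))%R by rewrite mulr_ge0// divr_ge0//; lra.
(* The positive part bounds the sum of the jumps of [t^(q - 1)] over the levels between the base and
   [2 * H x]; only at those levels does the truncation in [weak_type_halved] see [x]. *)
have I0 (u : R) x : (0 <= H x * Num.max 0 ((2 * H x) `^ (q - 1) - u `^ (q - 1)))%R.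
  by rewrite mulr_ge0// le_max lexx.
have mI (u : R) : measurable_fun [set: T]
    (fun x => (H x * Num.max 0 ((2 * H x) `^ (q - 1) - u `^ (q - 1)))%:E).
  apply/measurable_EFinP; apply: measurable_funM => //.
  apply: measurable_maxr => //; apply: measurable_funB => //.
  by apply: measurable_fun_powR; exact: measurable_funM.
have [n] := ubnP (size s); elim: n s t => // n IH s t ssn t0 cs tm.
have [->|sn0] := eqVneq s [::].
  by rewrite big_nil mule_ge0// integral_ge0// => x _; rewrite lee_fin.
have [i0 i0s i0min] := seq_argmin m sn0.
set t0' := m i0; have tt0 : (t <= t0')%R by exact: tm.
have t0'0 : (0 <= t0')%R by exact: le_trans tt0.
have us : uniq s by case: cs.
have {}IH := IH (rem i0 s) t0'; move: IH.
rewrite size_rem// prednK ?lt0n ?size_eq0//.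
move=> /(_ ssn t0'0).
move=> {}IH; have cs' : carleson_family (rem i0 s).
  by apply: carleson_family_sub cs; [exact: rem_uniq|exact: mem_rem].
have {}IH := IH cs' (fun i si => i0min _ (mem_rem si)).
have Em i : i \in s -> (t `^ q <= t0' `^ q <= m i `^ q)%R.
  move=> si; have t0m := i0min _ si.
  have mi0 : (0 <= m i)%R := le_trans t0'0 t0m.
  by rewrite !ge0_ler_powR ?nnegrE//; lra.
have tq1 : (0 <= t0' `^ (q - 1) - t `^ (q - 1))%R.
  by rewrite subr_ge0 ge0_ler_powR ?nnegrE//; exact: ltW.
(* Every coefficient is split at [t0']. The index [i0] leaves the first sum because [m i0] is [t0'];
   the second sum keeps all of [s], since every level is at least [t0']. *)
have -> : \sum_(i <- s) (m i `^ q - t `^ q)%:E * mu (E i) =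
    \sum_(i <- rem i0 s) (m i `^ q - t0' `^ q)%:E * mu (E i) +
    (t0' `^ q - t `^ q)%:E * \sum_(i <- s) mu (E i).
  transitivity (\sum_(i <- s) (m i `^ q - t0' `^ q)%:E * mu (E i) +
      (t0' `^ q - t `^ q)%:E * \sum_(i <- s) mu (E i)).
    rewrite ge0_sume_distrr//.
    rewrite -big_split/=; apply: eq_big_seq => i /Em/andP[h1 h2].
    rewrite -ge0_muleDl ?lee_fin ?subr_ge0// -EFinD.
    by congr (_%:E * _); rewrite addrA subrK.
  by rewrite (big_rem i0 i0s)/= subrr mul0e add0e.
apply: le_trans (leeD IH (_ : _ <= (2 * (q / (q - 1)))%:E *
  ((t0' `^ (q - 1) - t `^ (q - 1))%:E *
   \int[mu]_x (if (t0' < 2 * H x)%R then H x else 0)%:E))) _.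
  apply: (@le_trans _ _ ((q / (q - 1) * (t0' * (t0' `^ (q - 1) - t `^ (q - 1))))%:E *
      \sum_(i <- s) mu (E i))).
    by rewrite lee_wpmul2r ?sume_ge0// lee_fin powR_sub_le.
  rewrite (_ : (q / (q - 1) * (t0' * (t0' `^ (q - 1) - t `^ (q - 1))))%R =
    ((q / (q - 1) * (t0' `^ (q - 1) - t `^ (q - 1))) * t0')%R); last by ring.
  rewrite EFinM -muleA.
  rewrite (_ : (2 * (q / (q - 1)))%:E * ((t0' `^ (q - 1) - t `^ (q - 1))%:E * _) =
     (q / (q - 1) * (t0' `^ (q - 1) - t `^ (q - 1)))%:E * (2%:E *
   \int[mu]_x (if (t0' < 2 * H x)%R then H x else 0)%:E)); last first.
    by rewrite !muleA -!EFinM; congr (_%:E * _); ring.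
  apply: lee_wpmul2l.
    by rewrite lee_fin mulr_ge0// divr_ge0//; lra.
  by apply: weak_type_halved.
have mK : measurable_fun [set: T] (fun x => (if (t0' < 2 * H x)%R then H x else 0)%:E).
  apply/measurable_EFinP; apply: measurable_fun_ifT => //.
  apply: measurable_fun_ltr => //; exact: measurable_funM.
have K0 x : 0 <= (if (t0' < 2 * H x)%R then H x else 0)%:E by case: ifPn; rewrite lee_fin.
rewrite -ge0_muleDr; last 2 first.
- by apply: integral_ge0 => x _; rewrite lee_fin.
- by rewrite mule_ge0// integral_ge0// => x _.
rewrite lee_wpmul2l//.
rewrite -(@ge0_integralZl _ _ _ mu setT measurableT _ mK)//.
rewrite -ge0_integralD//; last 3 first.
- by move=> x _; rewrite lee_fin.
- by move=> x _; rewrite mule_ge0// lee_fin.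
- exact: measurable_funeM.
apply: ge0_le_integral_any => x _.
  by rewrite adde_ge0//; [rewrite lee_fin|rewrite mule_ge0// lee_fin].
rewrite -EFinM -EFinD lee_fin.
(* Where [t0' < 2 * H x] the jumps telescope to an equality; elsewhere the truncation is 0 and
   raising the base level only lowers the positive part. *)
case: ltP => [t0H|_]; last first.
  rewrite mulr0 addr0 ler_wpM2l// ge_max le_max lexx/= le_max.
  by rewrite lerD2l lerN2 orbC -subr_ge0 tq1.
have h : (t0' `^ (q - 1) <= (2 * H x) `^ (q - 1))%R.
  by rewrite ge0_ler_powR ?nnegrE ?mulr_ge0//; exact: ltW.
rewrite !max_r ?subr_ge0//; last by lra.
by rewrite le_eqVlt; apply/orP; left; apply/eqP; ring.
Qed.

(** This is base level 0. In [2^q], one factor 2 comes from the halving in the weak-type bound and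
    [2^(q - 1)] from evaluating the power at [2 * H x]. *)
Lemma carleson_embedding (s : seq I) : carleson_family s ->
  (forall i, i \in s -> (0 <= m i)%R) ->
  \sum_(i <- s) (m i `^ q)%:E * mu (E i) <=
  (2 `^ q * (q / (q - 1)))%:E * \int[mu]_x (H x `^ q)%:E.
Proof.
move=> cs m0; have := carleson_embedding_above (lexx 0%R) cs m0.
have hq := q1; have z0 : (0 `^ q = 0 :> R)%R by rewrite powR0// gt_eqF//; lra.
under eq_bigr do rewrite z0 subr0.
move=> /le_trans; apply.
rewrite (_ : (fun x => _) = (fun x => (2 `^ (q - 1))%:E * (H x `^ q)%:E)); last first.
  apply/funext => x; rewrite powR0 ?gt_eqF//; last by lra.
  rewrite subr0 max_r ?powR_ge0// powRM// -EFinM; congr _%:E.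
  by rewrite mulrCA mulr_powRB1//; lra.
rewrite ge0_integralZl//; last 2 first.
- exact/measurable_EFinP/measurable_fun_powR.
- by move=> x _; rewrite lee_fin powR_ge0.
rewrite muleA -EFinM.
rewrite (_ : (2 * (q / (q - 1)) * 2 `^ (q - 1))%R = (2 `^ q * (q / (q - 1)))%R)//.
by rewrite -[in RHS](@mulr_powRB1 _ 2 q)//; [ring|lra].
Qed.

End carleson_embedding.

(** * Geometry of dyadic lattices *)

Section cubes.
Variables (R : realType) (n : nat).
Local Notation E := (Rn R n).
Local Notation leb := (lebesgue R n).
Local Notation cubeT := (cube R n).

Lemma measurable_cube (Q : cubeT) : measurable (cube_set Q : set E).
Proof.
apply: sub_caratheodory; apply: sub_sigma_algebra.
exact: measurable_box.
Qed.

Lemma cube_volume_gt0 (Q : cubeT) : 0 < Q.2%:num ^+ n.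
Proof. by rewrite exprn_gt0. Qed.

(** Both cubes sit in grids of generations [k1 <= k2] of a common ancestor. In units of the finer
    side [L], their offsets from its corner are integers: either the finer index lies in the coarser
    range in every coordinate, or in some coordinate the two half-open intervals are disjoint. *)
Lemma dyadic_lattice_nested (D : set cubeT) (P1 P2 : cubeT) :
  dyadic_lattice D -> D P1 -> D P2 ->
  [\/ cube_set P1 `<=` cube_set P2, cube_set P2 `<=` cube_set P1 |
      cube_set P1 `&` cube_set P2 = set0].
Proof.
move=> [_ anc _] D1 D2; have [Q [_ d1 d2]] := anc _ _ D1 D2.
move: d1 d2 => [k1 [m1 [s1 c1]]] [k2 [m2 [s2 c2]]] {D1 D2 anc}.
wlog le12 : P1 P2 k1 m1 s1 c1 k2 m2 s2 c2 / (k1 <= k2)%N.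
  move=> H; have [|] := leqP k1 k2; first exact: (H P1 P2 k1 m1 s1 c1 k2 m2 s2 c2).
  move=> /ltnW /(H P2 P1 k2 m2 s2 c2 k1 m1 s1 c1)[H21|H12|H0].
  - by apply: Or32.
  - by apply: Or31.
  - by apply: Or33; rewrite setIC.
pose d := (k2 - k1)%N.
set L := Q.2%:num / 2 ^+ k2 in s2 c2.
have L0 : 0 < L by rewrite divr_gt0// exprn_gt0.
have e1 : Q.2%:num / 2 ^+ k1 = (2 ^ d)%:R * L.
  rewrite /L natrX -(subnKC le12) exprD -/d.
  have two k : (2 : R) ^+ k != 0 by rewrite expf_neq0// pnatr_eq0.
  by field; rewrite !two.
rewrite e1 in s1 c1.
have [sub|/existsNP[i /negP]] := pselect (forall i, (m1 i * 2 ^ d <= m2 i < (m1 i).+1 * 2 ^ d)%N).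
  apply: Or32 => x /= x2 i; have := x2 i; rewrite c1 c2 s1 s2.
  have /andP[h1 h2] := sub i => /andP[h3 h4].
  have h1' : (m1 i)%:R * (2 ^ d)%:R * L <= (m2 i)%:R * L.
    by rewrite (ler_pM2r L0) -natrM ler_nat.
  have h2' : ((m2 i)%:R + 1) * L <= ((m1 i)%:R + 1) * (2 ^ d)%:R * L.
    by rewrite (ler_pM2r L0) !natr1 -natrM ler_nat.
  by apply/andP; split; lra.
rewrite negb_and -!ltnNge => h; apply: Or33; apply/seteqP; split => // x [/= x1 x2].
have := x1 i; have := x2 i; rewrite c1 c2 s1 s2 => /andP[h3 h4] /andP[h5 h6].
move: h => /orP[h|h].
  have h2' : ((m2 i)%:R + 1) * L <= (m1 i)%:R * (2 ^ d)%:R * L.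
    by rewrite (ler_pM2r L0) !natr1 -natrM ler_nat.
  by lra.
have h2' : ((m1 i)%:R + 1) * (2 ^ d)%:R * L <= (m2 i)%:R * L.
  by rewrite (ler_pM2r L0) !natr1 -natrM ler_nat.
by lra.
Qed.

(** Every cube shares an ancestor with a fixed [Q0], hence is reached by going up from [Q0] and down
    again, which is encoded by two generations and two integer vectors. Countability serves to
    measure the sum over [S] and to unite exceptional null sets. *)
Lemma dyadic_lattice_countable (D : set cubeT) : dyadic_lattice D -> countable D.
Proof.
move=> [_ anc cov].
have [Q0 DQ0 _] := cov set0 (@compact0 _).
pose X : countType := (nat * {ffun 'I_n -> nat} * (nat * {ffun 'I_n -> nat}))%type.
have sp k k' : 0 < Q0.2%:num * 2 ^+ k / 2 ^+ k' by rewrite divr_gt0// ?mulr_gt0// exprn_gt0.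
(* Going up [k0] generations from [Q0] leads to the side [Q0.2 * 2^k0] and the corner
   [Q0.1 - m0 * Q0.2]; [g] then descends from there. *)
pose g (x : X) : cubeT :=
  (\row_i (Q0.1 ord0 i - (x.1.2 i)%:R * Q0.2%:num +
           (x.2.2 i)%:R * (Q0.2%:num * 2 ^+ x.1.1 / 2 ^+ x.2.1)),
   PosNum (sp x.1.1 x.2.1)).
apply: (@sub_countable _ _ D (g @` [set: X])); last first.
  by apply: card_le_trans (card_image_le _ _) _; exact: countableP.
apply: subset_card_le => P DP.
have [Q [_ [k0 [m0 [s0 c0]]] [k [m [s c]]]]] := anc _ _ DQ0 DP.
exists (k0, [ffun i => m0 i : nat], (k, [ffun i => m i : nat])) => //.
have QE : Q.2%:num = Q0.2%:num * 2 ^+ k0.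
  by rewrite s0 mulfVK// expf_neq0// pnatr_eq0.
case: P DP s c => P1 P2 /= DP s c; rewrite /g/=; congr (_, _).
  apply/rowP => i; rewrite mxE !ffunE c -QE; congr (_ + _).
  by rewrite c0 s0 addrK.
by apply/val_inj; rewrite /= s QE.
Qed.

Lemma weight_integral_cube (w : E -> R) (Q : cubeT) : weight w ->
  (\int[leb]_(x in cube_set Q) (w x)%:E < +oo)%E.
Proof.
move=> [w0 mw]; pose K := [set v : 'rV[R]_n | forall i,
  v ord0 i \in `[Q.1 ord0 i, Q.1 ord0 i + Q.2%:num]].
have cK : compact K.
  have := @rV_compact R n (fun i => `[Q.1 ord0 i, Q.1 ord0 i + Q.2%:num]%classic).
  by apply=> i; exact: segment_compact.
move=> /(_ K cK); apply: le_lt_trans.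
rewrite integral_mkcond [leRHS]integral_mkcond.
apply: ge0_le_integral_any => x _.
  by apply: erestrict_ge0 => y _; rewrite lee_fin.
rewrite /patch; case: ifPn => [|_]; last by case: ifPn; rewrite ?lee_fin.
rewrite inE /= => Qx; rewrite mem_set// => i; have /andP[h1 h2] := Qx i.
by rewrite in_itv/= h1 ltW.
Qed.

End cubes.

(** * Young functions and their complements *)

Section young_functions.
Variable R : realType.

Lemma powRK (p x : R) : p != 0 -> 0 <= x -> (x `^ p) `^ p^-1 = x.
Proof. by move=> p0 x0; rewrite -powRrM mulfV// powRr1. Qed.

Lemma powRVK (p x : R) : p != 0 -> 0 <= x -> (x `^ p^-1) `^ p = x.
Proof. by move=> p0 x0; rewrite -powRrM mulVf// powRr1. Qed.

Lemma young_lt (A : R -> R) s t : young A -> 0 <= s -> s < t -> A s < A t.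
Proof.
move=> [_ inc _ _] s0 st; apply: inc => //; rewrite in_itv/= andbT//.
exact: ltW (le_lt_trans s0 st).
Qed.

Lemma young_le (A : R -> R) s t : young A -> 0 <= s -> s <= t -> A s <= A t.
Proof.
by move=> yA s0; rewrite le_eqVlt => /predU1P[->//|/(young_lt yA s0)/ltW].
Qed.

Lemma young_ge0 (A : R -> R) t : young A -> 0 <= t -> 0 <= A t.
Proof. by move=> yA t0; have [_ _ <- _] := yA; exact: young_le. Qed.

Lemma measurable_young d (T : measurableType d) (A : R -> R) (k : T -> R) :
  young A -> (forall x, 0 <= k x) -> measurable_fun [set: T] k ->
  measurable_fun [set: T] (fun x => A (k x)).
Proof.
move=> yA k0 mk.
(* [A] is controlled on [[0, +oo[] only; freezing it at negative arguments makes it monotone on the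
   whole line, hence measurable. *)
have -> : (fun x => A (k x)) = (fun t => A (Num.max 0 t)) \o k.
  by apply/funext => x /=; rewrite max_r.
apply: measurableT_comp mk; apply: nondecreasing_measurable => // s t st.
apply: young_le => //; first by rewrite le_max lexx.
by rewrite ge_max le_max lexx/= le_max st orbT.
Qed.

(** Superlinear growth gives [k * t <= A t] beyond a threshold, and below it the linear term is
    bounded. This bounds the set whose supremum defines [complementary], and for [k = 1] dominates
    [t] by a constant plus [A t]. *)
Lemma young_growth (A : R -> R) (k : R) : proper_young A ->
  exists2 T : R, 0 <= T & forall t, 0 <= t -> k * t <= `|k| * T + A t.
Proof.
move=> [yA /cvgryPge/(_ k) [M [_ hM]] _].
exists `|M| => // t t0; have At := young_ge0 yA t0.
have [tM|Mt] := leP t `|M|.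
  apply: le_trans (_ : `|k| * `|M| <= _); last by rewrite lerDl.
  apply: le_trans (ler_norm _) _; rewrite normrM ler_wpM2l//.
  by rewrite (ger0_norm t0).
have tp : 0 < t := le_lt_trans (normr_ge0 _) Mt.
have := hM t (le_lt_trans (ler_norm _) Mt).
rewrite ler_pdivlMr// => /le_trans; apply.
by rewrite lerDr mulr_ge0.
Qed.

Lemma young_inequality (A : R -> R) s t : proper_young A -> young (complementary A) ->
  0 <= s -> 0 <= t -> s * t <= A t + complementary A s.
Proof.
move=> pA yB s0; rewrite le_eqVlt => /predU1P[<-|t0].
  rewrite mulr0 addr_ge0//; first by apply: young_ge0 => //; case: pA.
  exact: young_ge0.
rewrite -lerBlDl; apply: sup_upper_bound; last by exists t.
split; first by exists (s * t - A t), t.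
have [T _ hT] := young_growth s pA.
exists (`|s| * T) => _ [u /= u0 <-].
by rewrite lerBlDr; apply: hT; exact: ltW.
Qed.

End young_functions.

(** * Luxemburg norms: Hoelder's inequality, vanishing, and the maximal operator *)

Section luxemburg_norm.
Variables (R : realType) (n : nat).
Local Notation E := (Rn R n).
Local Notation leb := (lebesgue R n).
Local Notation cubeT := (cube R n).
Local Open Scope ereal_scope.

Lemma average_le (Q : cubeT) (g : E -> \bar R) (k : R) :
  average Q g <= k%:E -> \int[leb]_(x in cube_set Q) g x <= (k * Q.2%:num ^+ n)%:E.
Proof.
rewrite /average lebesgue_cube/= lee_pdivrMl ?cube_volume_gt0// => h.
by rewrite mulrC EFinM.
Qed.

Lemma luxemburg_ge0 (Phi : R -> R) (f : E -> R) (Q : cubeT) : 0 <= luxemburg Phi f Q.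
Proof. by apply: le_ereal_inf_tmp => _ [l [l0 _] <-]; rewrite lee_fin ltW. Qed.

Lemma luxemburg_lty (Phi : R -> R) (f : E -> R) (Q : cubeT) :
  luxemburg Phi f Q < +oo -> exists l : R, (0 < l)%R /\
    average Q (fun x => (Phi (`|f x| / l))%:E) <= 1.
Proof.
by move=> /ereal_inf_lt[_ [l hl _] _]; exists l.
Qed.

Lemma luxemburg_le_maximal (Phi : R -> R) (f : E -> R) (Q : cubeT) (x : E) :
  cube_set Q x -> luxemburg Phi f Q <= maximal Phi f x.
Proof. by move=> Qx; apply: ereal_sup_ubound; exists Q. Qed.

Lemma maximal_ge0 (Phi : R -> R) (f : E -> R) (x : E) : 0 <= maximal Phi f x.
Proof.
(* The unit cube with lower corner [x] contains [x], so the supremum is not the value [-oo] of an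
   empty family. *)
apply: le_trans (luxemburg_ge0 Phi f ((x : 'rV_n), PosNum (@ltr01 R))) _.
by apply: luxemburg_le_maximal => i /=; rewrite lexx/= ltrDl.
Qed.

Section holder.
Variables (A : R -> R) (p : R) (h w : E -> R) (Q : cubeT).
Hypotheses (pA : proper_young A) (yB : young (complementary A)) (p0 : (0 < p)%R).
Hypotheses (mh : measurable_fun [set: E] h) (h0 : forall x, (0 <= h x)%R).
Hypotheses (mw : measurable_fun [set: E] w) (w0 : forall x, (0 <= w x)%R).
Let Ap := fun t : R => A (t `^ p^-1)%R.

(** The reason for passing from [A] to [Ap]: a level [l] is admissible for [w] and [Ap] exactly when
    [l^(1/p)] is admissible for [w^(1/p)] and [A]. Thus [luxemburg Ap w Q] is the [p]-th power of
    the norm of [w^(1/p)] for [A]. *)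
Let Ap_arg (l : R) : (0 < l)%R ->
  (fun x => (Ap (`|w x| / l))%:E) = (fun x => (A (w x `^ p^-1 / l `^ p^-1))%:E).
Proof.
move=> l0; apply/funext => x; rewrite /Ap ger0_norm// powRM//; last by rewrite invr_ge0 ltW.
by rewrite -(powR_inv1 (ltW l0)) -powRrM (mulrC (-1)%R) powRrM powR_inv1 ?powR_ge0.
Qed.

Let mAp (l : R) : (0 < l)%R ->
  measurable_fun [set: E] (fun x => (A (w x `^ p^-1 / l `^ p^-1))%:E).
Proof.
move=> l0; apply/measurable_EFinP; apply: measurable_young; first by case: pA.
  by move=> x; rewrite divr_ge0 ?powR_ge0.
exact: (measurable_funM (measurable_fun_powR p^-1 mw) (measurable_cst _)).
Qed.

Let Ap_ge0 (l : R) x : (0 <= A (w x `^ p^-1 / l `^ p^-1))%R.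
Proof. by apply: young_ge0; [case: pA|rewrite divr_ge0 ?powR_ge0]. Qed.

(** Young's inequality is applied pointwise to the rescaled functions; each of the two averages
    contributes at most 1, whence the factor 2. *)
Lemma holder_admissible (l1 l2 : R) : (0 < l1)%R -> (0 < l2)%R ->
  average Q (fun x => (complementary A (`|h x| / l1))%:E) <= 1 ->
  average Q (fun x => (Ap (`|w x| / l2))%:E) <= 1 ->
  \int[leb]_(x in cube_set Q) (h x * w x `^ p^-1)%:E <=
  (2 * Q.2%:num ^+ n * l1 * l2 `^ p^-1)%:E.
Proof.
move=> l10 l20 /average_le H1; rewrite Ap_arg// => /average_le H2.
set k2 := (l2 `^ p^-1)%R; have k20 : (0 < k2)%R by rewrite powR_gt0.
have l1e : (fun x => (complementary A (`|h x| / l1))%:E) =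
           (fun x => (complementary A (h x / l1))%:E).
  by apply/funext => x; rewrite ger0_norm.
rewrite l1e in H1.
have mB : measurable_fun [set: E] (fun x => (complementary A (h x / l1))%:E).
  apply/measurable_EFinP/(measurable_young yB).
    by move=> x; rewrite divr_ge0// ltW.
  exact: (measurable_funM mh (measurable_cst _)).
have B0 x : (0 <= complementary A (h x / l1))%R.
  by apply: young_ge0 => //; rewrite divr_ge0// ltW.
apply: (@le_trans _ _ (\int[leb]_(x in cube_set Q)
   ((l1 * k2)%:E * ((A (w x `^ p^-1 / k2))%:E + (complementary A (h x / l1))%:E)))).
  apply: ge0_le_integral_any => x _; first by rewrite lee_fin mulr_ge0 ?powR_ge0.
  rewrite -EFinD -EFinM lee_fin.
  rewrite (_ : (h x * _)%R = l1 * k2 * (h x / l1 * (w x `^ p^-1 / k2)))%R; last first.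
    by field; rewrite !gt_eqF.
  rewrite ler_pM2l ?mulr_gt0//.
  apply: young_inequality => //; first by rewrite divr_ge0// ltW.
  by rewrite divr_ge0 ?powR_ge0.
have mQ := measurable_cube Q.
have m2Q := measurable_funTS (D := cube_set Q) (mAp l20).
have mBQ := measurable_funTS (D := cube_set Q) mB.
rewrite (ge0_integralZl _ mQ (emeasurable_funD m2Q mBQ)); last 2 first.
- by move=> x _; rewrite adde_ge0 ?lee_fin//; exact: Ap_ge0.
- by rewrite lee_fin ltW// mulr_gt0.
rewrite (ge0_integralD _ mQ _ m2Q _ mBQ); last 2 first.
- by move=> x _; rewrite lee_fin; exact: Ap_ge0.
- by move=> x _; rewrite lee_fin.
apply: (@le_trans _ _ ((l1 * k2)%:E * ((1 * Q.2%:num ^+ n)%:E + (1 * Q.2%:num ^+ n)%:E))).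
  by apply: lee_wpmul2l; [rewrite lee_fin ltW// mulr_gt0|exact: leeD].
by rewrite -EFinD -EFinM lee_fin le_eqVlt; apply/orP; left; apply/eqP; ring.
Qed.

(** The infima are not assumed to be attained, so the admissible levels tend to them one at a time:
    first the level of [h] with that of [w] fixed ([step1]), then the level of [w]. The second
    passage divides by [b], so [b = 0] is treated apart. *)
Lemma luxemburg_holder (a b : R) :
  luxemburg (complementary A) h Q = b%:E -> luxemburg Ap w Q = a%:E ->
  \int[leb]_(x in cube_set Q) (h x * w x `^ p^-1)%:E <=
  (2 * Q.2%:num ^+ n * b * a `^ p^-1)%:E.
Proof.
move=> hb ha; set J := \int[leb]_(x in _) _.
have b0 : (0 <= b)%R by rewrite -lee_fin -hb luxemburg_ge0.
have a0 : (0 <= a)%R by rewrite -lee_fin -ha luxemburg_ge0.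
have [l1 [l10 av1]] : exists l : R, (0 < l)%R /\
    average Q (fun x => (complementary A (`|h x| / l))%:E) <= 1.
  by apply: luxemburg_lty; rewrite hb ltry.
have [l2 [l20 av2]] : exists l : R, (0 < l)%R /\
    average Q (fun x => (Ap (`|w x| / l))%:E) <= 1.
  by apply: luxemburg_lty; rewrite ha ltry.
have J0 : 0 <= J by apply: integral_ge0 => x _; rewrite lee_fin mulr_ge0 ?powR_ge0.
have Jfin : J \is a fin_num.
  rewrite ge0_fin_numE//; apply: le_lt_trans (holder_admissible l10 l20 av1 av2) _.
  by rewrite ltry.
have V0 := cube_volume_gt0 Q.
set V := (Q.2%:num ^+ n)%R in V0 *.
have step1 (l : R) : (0 < l)%R -> average Q (fun x => (Ap (`|w x| / l))%:E) <= 1 ->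
    (fine J <= 2 * V * b * l `^ p^-1)%R.
  move=> l0 avl; have k0 : (0 < 2 * V * l `^ p^-1)%R by rewrite !mulr_gt0 ?powR_gt0.
  rewrite (_ : (2 * V * b * l `^ p^-1 = b * (2 * V * l `^ p^-1))%R); last by ring.
  rewrite -ler_pdivrMr// -lee_fin -hb; apply: le_ereal_inf_tmp => _ [l' [l'0 avl'] <-].
  rewrite lee_fin ler_pdivrMr// -lee_fin fineK//.
  apply: le_trans (holder_admissible l'0 l0 avl' avl) _.
  by rewrite lee_fin le_eqVlt; apply/orP; left; apply/eqP; rewrite /V; ring.
rewrite -(fineK Jfin) lee_fin.
have [b00|bn0] := eqVneq b 0%R.
  by have := step1 _ l20 av2; rewrite b00 !mulr0 !mul0r.
have bp : (0 < b)%R by rewrite lt_def bn0.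
have k0 : (0 < 2 * V * b)%R by rewrite !mulr_gt0.
have fJ0 : (0 <= fine J / (2 * V * b))%R by rewrite divr_ge0 ?fine_ge0// ltW.
rewrite mulrC -ler_pdivrMr//.
rewrite -[leLHS](powRK (lt0r_neq0 p0) fJ0).
rewrite ge0_ler_powR ?nnegrE ?powR_ge0 ?invr_ge0 ?(ltW p0)//.
rewrite -lee_fin -ha; apply: le_ereal_inf_tmp => _ [l [l0 avl] <-].
rewrite lee_fin -[leRHS](powRVK (lt0r_neq0 p0) (ltW l0)).
rewrite ge0_ler_powR ?nnegrE ?powR_ge0 ?(ltW p0)//.
by rewrite ler_pdivrMr// mulrC; exact: step1.
Qed.

(** From [t <= T + A t], the integral of [w^(1/p)] over [Q] is at most a constant times [l^(1/p)]
    for every admissible [l], and such levels come arbitrarily close to 0. *)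
Lemma luxemburg_eq0_ae : luxemburg Ap w Q = 0 ->
  {ae leb, forall x, cube_set Q x -> w x = 0%R}.
Proof.
move=> lux0; have [T T0 hT] := young_growth 1%R pA.
have mQ := measurable_cube Q.
set J := \int[leb]_(x in cube_set Q) (w x `^ p^-1)%:E.
have V0 := cube_volume_gt0 Q.
set V := (Q.2%:num ^+ n)%R in V0 *.
have step (l : R) : (0 < l)%R -> average Q (fun x => (Ap (`|w x| / l))%:E) <= 1 ->
    J <= (l `^ p^-1 * ((T + 1) * V))%:E.
  move=> l0; rewrite Ap_arg// => /average_le avl.
  apply: (@le_trans _ _ (\int[leb]_(x in cube_set Q)
     ((l `^ p^-1)%:E * (T%:E + (A (w x `^ p^-1 / l `^ p^-1))%:E)))).
    apply: ge0_le_integral_any => x _; first by rewrite lee_fin powR_ge0.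
    rewrite -EFinD -EFinM lee_fin mulrC -ler_pdivrMr ?powR_gt0//.
    have := hT (w x `^ p^-1 / l `^ p^-1)%R; rewrite normr1 !mul1r; apply.
    by rewrite divr_ge0 ?powR_ge0.
  have mlQ := measurable_funTS (D := cube_set Q) (mAp l0).
  have mTQ : measurable_fun (cube_set Q : set E) (cst T%:E) := measurable_cst _.
  rewrite (ge0_integralZl _ mQ (emeasurable_funD mTQ mlQ)); last 2 first.
  - by move=> x _; rewrite adde_ge0// lee_fin.
  - by rewrite lee_fin powR_ge0.
  rewrite EFinM lee_wpmul2l ?lee_fin ?powR_ge0//.
  rewrite (ge0_integralD _ mQ _ mTQ _ mlQ); last 2 first.
  - by move=> x _; rewrite lee_fin.
  - by move=> x _; rewrite lee_fin.
  rewrite integral_cst// lebesgue_cube mulrDl EFinD EFinM.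
  by apply: leeD => //; rewrite mul1r in avl *.
have J0 : 0 <= J by apply: integral_ge0 => x _; rewrite lee_fin powR_ge0.
have [l2 [l20 av2]] : exists l : R, (0 < l)%R /\
    average Q (fun x => (Ap (`|w x| / l))%:E) <= 1.
  by apply: luxemburg_lty; rewrite lux0 ltry.
have Jfin : J \is a fin_num.
  by rewrite ge0_fin_numE//; apply: le_lt_trans (step _ l20 av2) _; rewrite ltry.
have k0 : (0 < (T + 1) * V)%R by rewrite mulr_gt0//; lra.
have fJ0 : (0 <= fine J / ((T + 1) * V))%R by rewrite divr_ge0 ?fine_ge0// ltW.
have : ((fine J / ((T + 1) * V)) `^ p <= 0)%R.
  rewrite -lee_fin -[leRHS]lux0; apply: le_ereal_inf_tmp => _ [l [l0 avl] <-].
  rewrite lee_fin -[leRHS](powRVK (lt0r_neq0 p0) (ltW l0)).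
  rewrite ge0_ler_powR ?nnegrE ?powR_ge0 ?(ltW p0)//.
  by rewrite ler_pdivrMr// -lee_fin fineK//; exact: step.
move=> hJ; have /powR_eq0_eq0 : ((fine J / ((T + 1) * V)) `^ p = 0)%R.
  by apply/eqP; rewrite eq_le hJ powR_ge0.
move/eqP; rewrite mulf_eq0 invr_eq0 (gt_eqF k0) orbF => /eqP fJ.
have : \int[leb]_(x in cube_set Q) `|(w x `^ p^-1)%:E| = 0.
  rewrite -[RHS](_ : J = _); last by rewrite -(fineK Jfin) fJ.
  by apply: eq_integral => x _; rewrite gee0_abs// lee_fin powR_ge0.
move/ae_eq_integral_abs => /(_ mQ); case.
  exact/measurable_funTS/measurable_EFinP/measurable_fun_powR.
move=> N [mN N0 hN]; exists N; split => // x /= hx; apply: hN => /= h'; apply: hx => Qx.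
by have /= [] := h' Qx => /powR_eq0_eq0.
Qed.

End holder.

(** The test function is the indicator of the unit cube, whose Luxemburg norm is at least [1 / M]
    once [Phi M > 1]. Positivity rules out the value [0 * +oo = 0] in the final bound and permits
    division by the norm in the discrete Hoelder inequality. *)
Lemma maximal_norm_gt0 (Phi : R -> R) (q : R) : young Phi -> (0 < q)%R ->
  0 < maximal_norm n Phi q.
Proof.
move=> yP q0.
pose Q0 : cubeT := (0%R, PosNum (@ltr01 R)).
have mQ := measurable_cube Q0.
pose f : E -> R := \1_(cube_set Q0).
have [M M0 PM] : exists2 M : R, (0 < M)%R & (1 < Phi M)%R.
  have [_ _ _ /cvgryPgt/(_ 1%R)[M [_ hM]]] := yP.
  by exists (`|M| + 1)%R; [rewrite ltr_wpDl|apply: hM; rewrite ltr_pwDr// ler_norm].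
have luxM : (M^-1)%:E <= luxemburg Phi f Q0.
  apply: le_ereal_inf_tmp => _ [l [l0 /average_le av] <-]; move: av.
  rewrite (_ : \int[leb]_(x in cube_set Q0) _ = \int[leb]_(x in cube_set Q0) (Phi l^-1)%:E); last first.
    by apply: eq_integral => x Qx; rewrite /f indicE Qx normr1 mul1r.
  rewrite integral_cst// lebesgue_cube/= expr1n !mulr1 mule1 lee_fin => Pl.
  rewrite lee_fin invf_ple ?posrE//; rewrite leNgt; apply/negP => /(young_lt yP (ltW M0)).
  by move: Pl PM; lra.
have mf : measurable_fun [set: E] f by exact: measurable_indic.
apply: (@lt_le_trans _ _ (Lnorm leb q%:E (maximal Phi f))); last first.
  apply: ereal_sup_ubound; exists f => //; split => //.
  rewrite unlock (_ : (fun x => _) = (fun x => (\1_(cube_set Q0) x)%:E)); last first.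
    apply/funext => x /=; rewrite /f indicE; case: (x \in _) => /=.
      by rewrite normr1 powR1.
    by rewrite normr0 powR0// gt_eqF.
  by rewrite integral_indic// setIT lebesgue_cube/= expr1n powR1.
rewrite unlock; apply: poweR_gt0.
apply: (@lt_le_trans _ _ (\int[leb]_x ((M^-1 `^ q)%:E * (\1_(cube_set Q0) x)%:E))).
  have m1 : measurable_fun [set: E] (fun x => (\1_(cube_set Q0) x)%:E : \bar R).
    exact/measurable_EFinP/measurable_indic.
  rewrite (ge0_integralZl _ measurableT m1)//; last by rewrite lee_fin powR_ge0.
  rewrite integral_indic// setIT lebesgue_cube/= expr1n mule1 lte_fin.
  by rewrite powR_gt0 ?invr_gt0.
apply: ge0_le_integral_any => x _; first by rewrite mule_ge0// lee_fin ?powR_ge0.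
rewrite indicE; have [Qx|_] := boolP (x \in cube_set Q0); last first.
  by rewrite mule0 poweR_ge0.
rewrite mule1 -poweR_EFin gt0_ler_poweR ?(ltW q0)//.
- by rewrite in_itv/= leey lee_fin invr_ge0 ltW.
- by rewrite in_itv/= leey abse_ge0.
- apply: le_trans luxM _; apply: le_trans (lee_abs _).
  by apply: luxemburg_le_maximal; move: Qx; rewrite inE.
Qed.

Lemma sum_luxemburg_le (Phi : R -> R) (q : R) (h : E -> R) (s : seq cubeT)
    (F : cubeT -> set E) : (0 < q)%R ->
  uniq s -> trivIset [set` s] F ->
  (forall Q, Q \in s -> measurable (F Q) /\ F Q `<=` cube_set Q) ->
  \sum_(Q <- s) (luxemburg Phi h Q) `^ q * leb (F Q) <=
  \int[leb]_x (`|maximal Phi h x| `^ q).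
Proof.
move=> q0 us tF sF.
apply: (@le_trans _ _ (\sum_(Q <- s) \int[leb]_x ((luxemburg Phi h Q) `^ q * (\1_(F Q) x)%:E))).
  rewrite le_eqVlt; apply/orP; left; apply/eqP; apply: eq_big_seq => Q /sF[mF _].
  have m1 : measurable_fun [set: E] (fun x => (\1_(F Q) x)%:E : \bar R).
    exact/measurable_EFinP/measurable_indic.
  rewrite (ge0_integralZl _ measurableT m1) ?poweR_ge0//.
  by rewrite integral_indic// setIT.
(* Sum and integral are exchanged by induction on sublists of [s], because [F Q] is known to be
   measurable only for [Q] in [s]. *)
have /(_ s)[//|_ ->] : forall s', {subset s' <= s} ->
    measurable_fun [set: E]
      (fun x => \sum_(Q <- s') ((luxemburg Phi h Q) `^ q * (\1_(F Q) x)%:E)) /\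
    \sum_(Q <- s') \int[leb]_x ((luxemburg Phi h Q) `^ q * (\1_(F Q) x)%:E) =
    \int[leb]_x \sum_(Q <- s') ((luxemburg Phi h Q) `^ q * (\1_(F Q) x)%:E).
  elim=> [|Q s' IH] s's.
    under eq_fun do rewrite big_nil; split => //.
    by rewrite big_nil integral0.
  have [mIH eIH] : _ /\ _ := IH (fun Q' Q's => s's Q' (@mem_behead _ (Q :: s') _ Q's)).
  have mQ : measurable_fun [set: E]
      (fun x => (luxemburg Phi h Q) `^ q * (\1_(F Q) x)%:E).
    have /s's/sF[mF _] := mem_head Q s'; apply: measurable_funeM.
    by apply/measurable_EFinP; exact: measurable_indic.
  rewrite (_ : (fun x => \sum_(Q' <- (Q :: s')) _) = (fun x =>
      (luxemburg Phi h Q) `^ q * (\1_(F Q) x)%:E +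
      \sum_(Q <- s') ((luxemburg Phi h Q) `^ q * (\1_(F Q) x)%:E))); last first.
    by apply/funext => x; rewrite big_cons.
  split; first exact: emeasurable_funD.
  rewrite big_cons eIH ge0_integralD//.
  - by move=> x _; rewrite mule_ge0 ?poweR_ge0// lee_fin.
  - by move=> x _; apply: sume_ge0 => Q' _; rewrite mule_ge0 ?poweR_ge0// lee_fin.
apply: ge0_le_integral_any => x _.
  by apply: sume_ge0 => Q' _; rewrite mule_ge0 ?poweR_ge0// lee_fin.
have [[Q Qs FQx]|nQ] := pselect (exists2 Q, Q \in s & F Q x); last first.
  rewrite big1_seq ?poweR_ge0// => Q /andP[_ Qs]; rewrite indicE memNset ?mule0// => FQ.
  by apply: nQ; exists Q.
rewrite (bigD1_seq Q)//= big1_seq ?adde0; last first.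
  move=> Q' /andP[Q'Q Q's]; rewrite indicE memNset ?mule0// => FQ'.
  by move/eqP: Q'Q; apply; apply: (tF _ _ Q's Qs); exists x.
rewrite indicE mem_set// mule1 gt0_ler_poweR ?(ltW q0)//.
- by rewrite in_itv/= leey luxemburg_ge0.
- by rewrite in_itv/= leey abse_ge0.
- apply: le_trans (lee_abs _).
  by apply: luxemburg_le_maximal; exact: (sF _ Qs).2.
Qed.

End luxemburg_norm.

(** * Conjugate exponents, Hoelder's inequality for sums, and duality *)

Lemma conj_exp_gt1 (R : realType) (p : R) : 1 < p -> 1 < conj_exp p.
Proof. by move=> p1; rewrite /conj_exp ltr_pdivlMr ?mul1r; lra. Qed.

Lemma conj_expV (R : realType) (p : R) : 1 < p -> p^-1 + (conj_exp p)^-1 = 1.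
Proof. by move=> p1; rewrite /conj_exp; field; apply/andP; split; lra. Qed.

(** Dividing by [U] and [V] reduces the claim to the numerical Young inequality, summed with weights
    [e]. If [U = 0], every term vanishes because [e i] or [x i] does. *)
Lemma sum_holder (R : realType) (I : eqType) (s : seq I) (e x y : I -> R) (p U V : R) :
  1 < p -> 0 <= U -> 0 < V ->
  (forall i, i \in s -> [/\ 0 <= e i, 0 <= x i & 0 <= y i]) ->
  \sum_(i <- s) e i * x i `^ p <= U `^ p ->
  \sum_(i <- s) e i * y i `^ conj_exp p <= V `^ conj_exp p ->
  \sum_(i <- s) e i * (x i * y i) <= U * V.
Proof.
move=> p1 U0 V0 s0 sU sV; have q1 := conj_exp_gt1 p1.
have p0 : 0 < p by lra.
have q0 : 0 < conj_exp p by lra.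
have [U00|Un0] := eqVneq U 0.
  rewrite U00 powR0 ?gt_eqF// in sU.
  rewrite U00 mul0r big_seq big1// => i si; have [e0 x0 y0] := s0 _ si.
  have : \sum_(i <- s | i \in s) e i * x i `^ p == 0.
    rewrite -big_seq eq_le; apply/andP; split.
      exact: sU.
    by rewrite big_seq sumr_ge0// => j /s0[? ? ?]; rewrite mulr_ge0 ?powR_ge0.
  rewrite psumr_eq0; last by move=> j /s0[? ? ?]; rewrite mulr_ge0 ?powR_ge0.
  move=> /allP/(_ _ si); rewrite si mulf_eq0 powR_eq0 => /orP[/eqP->|/andP[/eqP-> _]].
    by rewrite mul0r.
  by rewrite mul0r mulr0.
have Up : 0 < U by rewrite lt_def Un0.
have sc (c : R) (z : I -> R) (k : R) : 0 < c -> (forall i, i \in s -> 0 <= z i) ->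
    \sum_(i <- s) e i * z i `^ k <= c `^ k ->
    \sum_(i <- s) e i * (z i / c) `^ k <= 1.
  move=> c0 z0 h; have ck : 0 < c `^ k by rewrite powR_gt0.
  rewrite -(ler_pM2r ck) mul1r; apply: le_trans h; rewrite mulr_suml.
  rewrite le_eqVlt; apply/orP; left; apply/eqP; apply: eq_big_seq => i /z0 zi.
  by rewrite -mulrA -powRM ?divfK ?gt_eqF// ?divr_ge0// ltW.
have hx := sc U x p Up (fun i si => let: And3 _ h _ := s0 i si in h) sU.
have hy := sc V y _ V0 (fun i si => let: And3 _ _ h := s0 i si in h) sV.
rewrite -[leRHS]mul1r -ler_pdivrMr ?mulr_gt0// mulr_suml.
apply: (@le_trans _ _ (\sum_(i <- s) (e i * (x i / U) `^ p * p^-1 +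
   e i * (y i / V) `^ conj_exp p * (conj_exp p)^-1))).
  rewrite big_seq [leRHS]big_seq; apply: ler_sum => i /s0[e0 x0 y0].
  rewrite (_ : e i * (x i * y i) / (U * V) = e i * ((x i / U) * (y i / V))); last first.
    by field; rewrite !gt_eqF.
  rewrite -2!(mulrA (e i) (_ `^ _)) -mulrDr ler_wpM2l//; apply: conjugate_powR => //.
  - by rewrite divr_ge0// ltW.
  - by rewrite divr_ge0// ltW.
  - exact: conj_expV.
rewrite big_split/= -!mulr_suml -[leRHS](conj_expV p1).
by apply: lerD; rewrite ler_piMl// invr_ge0 ltW.
Qed.

(* The extremal test function is a multiple of [phi `^ (p - 1)]. *)
Lemma Lp_dual_bound d (T : measurableType d) (R : realType)
    (mu : {measure set T -> \bar R}) (phi : T -> R) (p B : R) :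
  1 < p -> 0 <= B -> measurable_fun [set: T] phi -> (forall x, 0 <= phi x) ->
  (\int[mu]_x (phi x `^ p)%:E < +oo)%E ->
  (forall h : T -> R, measurable_fun [set: T] h -> (forall x, 0 <= h x) ->
    (\int[mu]_x (h x `^ conj_exp p)%:E <= 1)%E ->
    (\int[mu]_x (phi x * h x)%:E <= B%:E)%E) ->
  (\int[mu]_x (phi x `^ p)%:E <= (B `^ p)%:E)%E.
Proof.
move=> p1 B0 mphi phi0 Xoo dual.
have p0 : 0 < p by lra.
have p10 : 0 < p - 1 by lra.
set X := (\int[mu]_x _)%E in Xoo *.
have X0 : (0 <= X)%E by apply: integral_ge0 => x _; rewrite lee_fin powR_ge0.
have Xfin : X \is a fin_num by rewrite ge0_fin_numE.
have [X00|Xn0] := eqVneq X 0%E; first by rewrite X00 lee_fin powR_ge0.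
have [t t0 XE] : exists2 t, 0 < t & X = t%:E.
  exists (fine X); last by rewrite fineK.
  by rewrite fine_gt0// Xoo andbT lt_def Xn0.
(* The power of [t] makes the integral of [h^p'] equal to 1, and the pairing with [phi] equal to
   [t^(1/p)]; both rest on [t] being finite and positive. *)
pose h x := phi x `^ (p - 1) * t `^ (- ((p - 1) / p)).
have mphip : measurable_fun [set: T] (fun x => (phi x `^ p)%:E).
  exact/measurable_EFinP/measurable_fun_powR.
have := dual h _ _ _.
have hq x : h x `^ conj_exp p = t^-1 * phi x `^ p.
  rewrite /h powRM ?powR_ge0// -!powRrM mulrC; congr (_ * _).
    rewrite /conj_exp (_ : - ((p - 1) / p) * (p / (p - 1)) = -1); last first.
      by field; rewrite !gt_eqF.
    by rewrite powR_inv1// ltW.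
  by congr (_ `^ _); rewrite /conj_exp; field; rewrite gt_eqF.
have ph x : phi x * h x = t `^ (- ((p - 1) / p)) * phi x `^ p.
  by rewrite /h mulrA mulr_powRB1// mulrC.
under eq_integral do rewrite hq EFinM.
under [X in _ -> _ -> _ -> (X <= _)%E]eq_integral do rewrite ph EFinM.
have phip0 x : [set: T] x -> (0 <= (phi x `^ p)%:E)%E by rewrite lee_fin powR_ge0.
have tV0 : (0 <= (t^-1)%:E)%E by rewrite lee_fin invr_ge0 ltW.
have tp0 : (0 <= (t `^ (- ((p - 1) / p)))%:E)%E by rewrite lee_fin powR_ge0.
rewrite (@ge0_integralZl _ _ _ mu setT measurableT _ mphip _ phip0 tV0).
rewrite (@ge0_integralZl _ _ _ mu setT measurableT _ mphip _ phip0 tp0).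
rewrite -/X XE -!EFinM mulVf ?gt_eqF// => H.
have {H} : t `^ (- ((p - 1) / p)) * t <= B.
  rewrite -lee_fin; apply: H => //.
    by apply: measurable_funM => //; exact: measurable_fun_powR.
  by move=> x; rewrite /h mulr_ge0 ?powR_ge0.
rewrite -[X in _ * X <= _](powRr1 (ltW t0)) -powRD; last by rewrite (gt_eqF t0) implybT.
rewrite (_ : _ + 1 = p^-1); last by field; rewrite gt_eqF.
move=> h1; rewrite lee_fin -[leLHS](powRVK (lt0r_neq0 p0) (ltW t0)).
by rewrite ge0_ler_powR ?nnegrE ?powR_ge0 ?(ltW p0)//.
Qed.

(** * The estimate for a finite list of cubes with finite data *)

Section finite_family.
Variables (R : realType) (n : nat) (r p eta N Y : R).
Local Notation E := (Rn R n).
Local Notation leb := (lebesgue R n).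
Local Notation cubeT := (cube R n).
Variables (w f : E -> R) (A : R -> R) (s : seq cubeT) (F : cubeT -> set E).
Variables (a c : cubeT -> R).
Let Ap := fun t : R => A (t `^ p^-1).
Hypotheses (r1 : 1 < r) (rp : r < p) (eta0 : 0 < eta) (ww : weight w).
Hypotheses (pA : proper_young A) (yB : young (complementary A)).
Hypothesis mf : measurable_fun [set: E] f.
Hypotheses (us : uniq s) (tF : trivIset [set` s] F).
Hypothesis sF : forall Q, Q \in s -> [/\ measurable (F Q), F Q `<=` cube_set Q &
  (eta%:E * leb (cube_set Q) <= leb (F Q))%E].
Hypothesis nest : forall P Q, P \in s -> Q \in s ->
  [\/ cube_set P `<=` cube_set Q, cube_set Q `<=` cube_set P |
      cube_set P `&` cube_set Q = set0].
Hypothesis ha : forall Q, Q \in s -> luxemburg Ap w Q = (a Q)%:E.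
Hypothesis hc : forall Q, Q \in s -> average Q (fun x => (f x `^ r)%:E) = (c Q)%:E.
Hypothesis hN : maximal_norm n (complementary A) (conj_exp p) = N%:E.
Hypothesis hY : (\int[leb]_x ((f x `^ p)%:E * maximal Ap w x) <= Y%:E)%E.
Local Open Scope ereal_scope.

Let a0 Q : Q \in s -> (0 <= a Q)%R.
Proof. by move=> /ha aE; rewrite -lee_fin -aE luxemburg_ge0. Qed.

Let intc Q : Q \in s ->
  \int[leb]_(x in cube_set Q) (f x `^ r)%:E = (c Q * Q.2%:num ^+ n)%:E.
Proof.
move=> /hc; rewrite /average lebesgue_cube/= => /(congr1 (mule (Q.2%:num ^+ n)%:E)).
by rewrite muleA -EFinM mulfV ?mul1e ?gt_eqF ?cube_volume_gt0// -EFinM mulrC.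
Qed.

Let c0 Q : Q \in s -> (0 <= c Q)%R.
Proof.
move=> sQ; rewrite -(pmulr_lge0 _ (cube_volume_gt0 Q)) -lee_fin -intc//.
by apply: integral_ge0 => x _; rewrite lee_fin powR_ge0.
Qed.

Let fin_lebF Q : Q \in s -> leb (F Q) \is a fin_num.
Proof.
move=> /sF[mF FQ _]; rewrite ge0_fin_numE//.
apply: (@le_lt_trans _ _ (leb (cube_set Q))); last by rewrite lebesgue_cube ltry.
by apply: le_measure; rewrite ?inE//; exact: measurable_cube.
Qed.

Let e Q := fine (leb (F Q)).

Let e_ge Q : Q \in s -> (eta * Q.2%:num ^+ n <= e Q)%R.
Proof.
move=> sQ; rewrite -lee_fin /e fineK ?fin_lebF//.
by have [_ _] := sF sQ; rewrite lebesgue_cube.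
Qed.

Let e_gt0 Q : Q \in s -> (0 < e Q)%R.
Proof. by move=> /e_ge; apply: lt_le_trans; rewrite mulr_gt0// cube_volume_gt0. Qed.

(* A measurable minorant of [M_{A_p} w] which dominates [a Q] on each [Q]. *)
Let u x : R := \big[Num.max/0%R]_(Q <- s) (a Q * \1_(cube_set Q) x)%R.

Let u_ge0 x : (0 <= u x)%R.
Proof.
rewrite /u big_seq; elim/big_ind: _ => // [y z y0 z0|Q sQ]; first by rewrite le_max y0.
by rewrite mulr_ge0 ?a0.
Qed.

Let measurable_u : measurable_fun [set: E] u.
Proof.
rewrite /u; move: s; elim=> [|Q s' IH].
  by under eq_fun do rewrite big_nil; exact: measurable_cst.
under eq_fun do rewrite big_cons.
apply: measurable_maxr; last exact: IH.
apply: measurable_funM; first exact: measurable_cst.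
by apply: measurable_indic; exact: measurable_cube.
Qed.

Let u_ge Q x : Q \in s -> cube_set Q x -> (a Q <= u x)%R.
Proof.
move=> sQ Qx; apply: (@le_trans _ _ (a Q * \1_(cube_set Q) x)%R).
  by rewrite indicE mem_set// mulr1.
exact: (le_bigmax_seq 0%R Q xpredT (fun Q => a Q * \1_(cube_set Q) x)%R).
Qed.

Let u_le x : (u x)%:E <= maximal Ap w x.
Proof.
have M0 : 0 <= maximal Ap w x by exact: maximal_ge0.
rewrite /u big_seq; elim/big_ind: _ => //.
  by move=> y z; rewrite /Num.max; case: ifP.
move=> Q sQ; rewrite indicE; have [Qx|_] := boolP (x \in _).
  by rewrite mulr1 -ha//; apply: luxemburg_le_maximal; rewrite inE in Qx.
by rewrite mulr0.
Qed.

(** Since [a Q <= u] on [Q], [m Q] is a lower bound of the average of [H]. The exponents are chosen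
    so that [m Q] to the power [p / r] is the summand and [H] to that power is [f^p * u]. The
    embedding requires [H] to be measurable, hence [u] in place of the maximal function. *)
Lemma finite_coefficients :
  (\sum_(Q <- s) e Q * (c Q `^ r^-1 * a Q `^ p^-1) `^ p <=
   2 `^ (p / r) * conj_exp (p / r) * Y)%R.
Proof.
have hr1 := r1; have hrp := rp.
have p0 : (0 < p)%R by lra.
have r0 : (0 < r)%R by lra.
have q1 : (1 < p / r)%R by rewrite ltr_pdivlMr// mul1r.
pose H x := (f x `^ r * u x `^ (r / p))%R.
pose m Q := (c Q * a Q `^ (r / p))%R.
have mH : measurable_fun [set: E] H.
  by apply: measurable_funM; exact: measurable_fun_powR.
have H0 x : (0 <= H x)%R by rewrite mulr_ge0 ?powR_ge0.
have m0 Q : Q \in s -> (0 <= m Q)%R by move=> /c0 ?; rewrite mulr_ge0 ?powR_ge0.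
have cf : carleson_family leb (@cube_set R n) F m H s.
  split => // Q sQ; have [mF FQ _] := sF sQ; have mQ := measurable_cube Q.
  split => //; first by rewrite lebesgue_cube ltry.
  rewrite lebesgue_cube -EFinM.
  rewrite (_ : (m Q * _)%R = (a Q `^ (r / p) * (c Q * Q.2%:num ^+ n))%R); last first.
    by rewrite /m; ring.
  have mfr : measurable_fun (cube_set Q : set E) (fun x => (f x `^ r)%:E).
    exact/measurable_funTS/measurable_EFinP/measurable_fun_powR.
  rewrite EFinM -intc// -(ge0_integralZl _ mQ mfr); last 2 first.
  - by move=> x _; rewrite lee_fin powR_ge0.
  - by rewrite lee_fin powR_ge0.
  apply: ge0_le_integral_any => x Qx; first by rewrite -EFinM lee_fin mulr_ge0 ?powR_ge0.
  rewrite -EFinM lee_fin mulrC ler_wpM2l ?powR_ge0//.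
  by rewrite ge0_ler_powR ?nnegrE ?a0 ?u_ge ?u_ge0 ?divr_ge0 ?(ltW p0) ?(ltW r0).
have := carleson_embedding q1 mH H0 cf m0.
rewrite -[(_ / (_ - 1))%R]/(conj_exp (p / r)).
have -> : \sum_(Q <- s) (m Q `^ (p / r))%:E * leb (F Q) =
    (\sum_(Q <- s) e Q * (c Q `^ r^-1 * a Q `^ p^-1) `^ p)%:E.
  rewrite -sumEFin; apply: eq_big_seq => Q sQ.
  rewrite -(fineK (fin_lebF sQ)) -EFinM mulrC; congr (_ * _)%:E%R.
  rewrite /m (powRM _ (c0 sQ) (powR_ge0 _ _)) (powRM _ (powR_ge0 _ _) (powR_ge0 _ _)).
  rewrite -!powRrM; congr (_ * _)%R.
    by congr (_ `^ _)%R; rewrite mulrC.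
  by congr (_ `^ _)%R; field; rewrite !gt_eqF.
move=> h; rewrite -lee_fin; apply: le_trans h _; rewrite [leRHS]EFinM.
have q'0 : (0 < conj_exp (p / r))%R by have := conj_exp_gt1 q1; lra.
apply: lee_wpmul2l; first by rewrite lee_fin mulr_ge0 ?powR_ge0 ?ltW.
apply: le_trans hY; apply: ge0_le_integral_any => x _; first by rewrite lee_fin powR_ge0.
rewrite /H powRM ?powR_ge0// -!powRrM.
rewrite (_ : (r * (p / r) = p)%R); last by field; rewrite gt_eqF.
rewrite (_ : (r / p * (p / r) = 1)%R); last by field; rewrite !gt_eqF.
by rewrite powRr1// EFinM lee_wpmul2l ?lee_fin ?powR_ge0.
Qed.

(** In [4 / eta], one factor 2 comes from the generalized Hoelder inequality, [1 / eta] from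
    sparseness, and the other 2 bounds [2^(1/r)] from the embedding. *)
Let B := (4 / eta * conj_exp (p / r) * N * Y `^ p^-1)%R.

Let N0 : (0 < N)%R.
Proof.
rewrite -lte_fin -hN; apply: maximal_norm_gt0 => //.
have hr1 := r1; have hrp := rp; have p1 : (1 < p)%R by lra.
by have := conj_exp_gt1 p1; lra.
Qed.

Let Y0 : (0 <= Y)%R.
Proof.
rewrite -lee_fin; apply: le_trans hY; apply: integral_ge0 => x _.
by rewrite mule_ge0 ?lee_fin ?powR_ge0// (le_trans _ (u_le x))// lee_fin.
Qed.

Lemma finite_bilinear (h : E -> R) : measurable_fun [set: E] h ->
  (forall x, (0 <= h x)%R) -> \int[leb]_x (h x `^ conj_exp p)%:E <= 1 ->
  \sum_(Q <- s) (c Q `^ r^-1)%:E * \int[leb]_(x in cube_set Q) (h x * w x `^ p^-1)%:E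
  <= B%:E.
Proof.
move=> mh h0 h1; have [w0 mw _] := ww.
have hr1 := r1; have hrp := rp; have p1 : (1 < p)%R by lra.
have p0 : (0 < p)%R by lra.
have r0 : (0 < r)%R by lra.
have q1 : (1 < p / r)%R by rewrite ltr_pdivlMr// mul1r.
have q'1 := conj_exp_gt1 q1.
have q'0 : (0 < conj_exp (p / r))%R by lra.
have p'1 := conj_exp_gt1 p1.
have p'0 : (0 < conj_exp p)%R by lra.
set Phi := complementary A; set k := conj_exp p.
set Z := \int[leb]_x (`|maximal Phi h x| `^ k).
have Z0 : 0 <= Z by apply: integral_ge0 => x _; rewrite poweR_ge0.
have ZN : Z `^ k^-1 <= N%:E.
  rewrite -hN; apply: ereal_sup_ubound; exists h; last by rewrite unlock.
  split => //; rewrite unlock -[leRHS](poweR1r k^-1).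
  have he : (fun x => `|(EFin \o h) x| `^ k) = (fun x => (h x `^ k)%:E).
    by apply/funext => x /=; rewrite ger0_norm.
  rewrite he gt0_ler_poweR ?invr_ge0 ?(ltW p'0)//.
    rewrite in_itv/= leey andbT; apply: integral_ge0 => x _.
    by rewrite lee_fin powR_ge0.
  by rewrite in_itv/= leey lee01.
have ZNk : Z <= (N `^ k)%:E.
  have -> : Z = (Z `^ k^-1) `^ k by rewrite -poweRrM mulVf ?poweRe1// gt_eqF.
  rewrite -poweR_EFin gt0_ler_poweR ?(ltW p'0)//.
    by rewrite in_itv/= leey poweR_ge0.
  by rewrite in_itv/= leey lee_fin ltW.
have sumZ : \sum_(Q <- s) (luxemburg Phi h Q) `^ k * leb (F Q) <= (N `^ k)%:E.
  by apply: le_trans ZNk; apply: sum_luxemburg_le => // Q /sF[].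
(* As [F Q] has positive measure, an infinite norm would make the sum in [sumZ] infinite. *)
have finb Q : Q \in s -> luxemburg Phi h Q \is a fin_num.
  move=> sQ; rewrite ge0_fin_numE ?luxemburg_ge0//.
  apply: (@lty_poweRy _ _ k); first by rewrite gt_eqF.
  rewrite ltey; apply/eqP => looE.
  have := sumZ; rewrite leNgt => /negP; apply.
  apply: (@lt_le_trans _ _ ((luxemburg Phi h Q) `^ k * leb (F Q))).
    by rewrite looE -(fineK (fin_lebF sQ)) gt0_mulye ?ltry// lte_fin; exact: e_gt0.
  rewrite (bigD1_seq Q)//= leeDl// sume_ge0// => Q' _.
  by rewrite mule_ge0 ?poweR_ge0.
pose b Q := fine (luxemburg Phi h Q).
have bE Q : Q \in s -> luxemburg Phi h Q = (b Q)%:E by move=> /finb/fineK.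
have b0 Q : Q \in s -> (0 <= b Q)%R by move=> _; rewrite fine_ge0 ?luxemburg_ge0.
have sumb : (\sum_(Q <- s) e Q * b Q `^ k <= N `^ k)%R.
  rewrite -lee_fin; apply: le_trans sumZ; rewrite -sumEFin le_eqVlt; apply/orP; left.
  apply/eqP; apply: eq_big_seq => Q sQ.
  by rewrite bE// poweR_EFin -(fineK (fin_lebF sQ)) -EFinM mulrC.
pose al Q := (c Q `^ r^-1 * a Q `^ p^-1)%R.
apply: (@le_trans _ _ (2 / eta * \sum_(Q <- s) e Q * (al Q * b Q))%R%:E).
  rewrite mulr_sumr -sumEFin big_seq [leRHS]big_seq; apply: lee_sum => Q sQ.
  apply: (@le_trans _ _ ((c Q `^ r^-1)%:E *
      (2 * Q.2%:num ^+ n * b Q * a Q `^ p^-1)%:E)).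
    rewrite lee_wpmul2l ?lee_fin ?powR_ge0//.
    exact: (luxemburg_holder pA yB p0 mh h0 mw w0 (bE _ sQ) (ha sQ)).
  rewrite -EFinM lee_fin.
  rewrite (_ : (c Q `^ r^-1 * (2 * Q.2%:num ^+ n * b Q * a Q `^ p^-1))%R =
    (2 / eta * ((eta * Q.2%:num ^+ n) * (al Q * b Q)))%R); last first.
    by rewrite /al; field; rewrite gt_eqF.
  rewrite ler_wpM2l ?divr_ge0 ?(ltW eta0)// ler_wpM2r ?e_ge//.
  by rewrite mulr_ge0 ?b0// mulr_ge0 ?powR_ge0.
set K := (2 `^ (p / r) * conj_exp (p / r) * Y)%R.
have K0 : (0 <= K)%R by rewrite (mulr_ge0 (mulr_ge0 _ (ltW q'0)) Y0)// powR_ge0.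
have := @sum_holder R _ s e al b p (K `^ p^-1) N p1 (powR_ge0 _ _) N0.
rewrite (powRVK (lt0r_neq0 p0) K0) => /(_ _ finite_coefficients sumb) H.
have {}H : (\sum_(Q <- s) e Q * (al Q * b Q) <= K `^ p^-1 * N)%R.
  by apply: H => Q sQ; rewrite b0// ltW ?e_gt0// mulr_ge0 ?powR_ge0.
rewrite lee_fin.
apply: le_trans (ler_wpM2l _ H) _; first by rewrite divr_ge0 ?(ltW eta0).
(* The root of [K] carries 2 to the power [1 / r] and [conj_exp (p / r)] to the power [1 / p]. Both
   bases are at least 1 and both exponents at most 1, so each factor is bounded by its base. *)
have KY : (K `^ p^-1 <= 2 * conj_exp (p / r) * Y `^ p^-1)%R.
  rewrite /K powRM//; last by rewrite mulr_ge0 ?powR_ge0// ltW.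
  rewrite powRM ?powR_ge0 ?(ltW q'0)//.
  apply: ler_wpM2r; first by rewrite powR_ge0.
  have pV1 : (p^-1 <= 1)%R by rewrite invf_le1//; lra.
  apply: ler_pM; rewrite ?powR_ge0//.
    rewrite -powRrM (_ : (p / r * p^-1 = r^-1)%R); last by field; rewrite !gt_eqF.
    apply: ler1_powR; first lra.
    by rewrite invf_le1//; lra.
  by apply: ler1_powR => //; lra.
rewrite /B (_ : (4 / eta * _ * N * _)%R = (2 / eta * ((2 * conj_exp (p / r) * Y `^ p^-1) * N))%R); last first.
  by field; rewrite gt_eqF.
by rewrite ler_wpM2l ?divr_ge0 ?(ltW eta0)// ler_wpM2r ?(ltW N0).
Qed.

Let integral_indicM Q (g : E -> R) :
  \int[leb]_x (\1_(cube_set Q) x * g x)%:E = \int[leb]_(x in cube_set Q) (g x)%:E.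
Proof.
rewrite [RHS]integral_mkcond; apply: eq_integral => x _.
by rewrite /patch indicE; case: ifPn => _; rewrite ?mul1r ?mul0r.
Qed.

Lemma finite_estimate :
  \int[leb]_x ((\sum_(Q <- s) c Q `^ r^-1 * \1_(cube_set Q) x) `^ p * w x)%:E
  <= (B `^ p)%:E.
Proof.
have [w0 mw _] := ww.
have hr1 := r1; have hrp := rp; have p1 : (1 < p)%R by lra.
have p0 : (0 < p)%R by lra.
have mcube (Q : cubeT) : measurable_fun [set: E] (\1_(cube_set Q) : E -> R).
  by apply: measurable_indic; exact: measurable_cube.
set S := fun x : E => (\sum_(Q <- s) c Q `^ r^-1 * \1_(cube_set Q) x)%R.
have S0 x : (0 <= S x)%R by apply: sumr_ge0 => Q _; rewrite mulr_ge0 ?powR_ge0.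
have mS : measurable_fun [set: E] S.
  by apply: measurable_sum => Q; exact: measurable_funM.
have mwp : measurable_fun [set: E] (fun x => w x `^ p^-1)%R.
  exact: measurable_fun_powR.
have mhwp (h : E -> R) : measurable_fun [set: E] h -> forall Q,
    measurable_fun [set: E] (fun x => (\1_(cube_set Q) x * (h x * w x `^ p^-1))%:E).
  move=> mh Q; apply/measurable_EFinP.
  exact: (measurable_funM (mcube Q) (measurable_funM mh mwp)).
have mQw Q : measurable_fun [set: E] (fun x => (\1_(cube_set Q) x * w x)%:E).
  apply/measurable_EFinP; exact: (measurable_funM (mcube Q) mw).
(* Moving [w^(1/p)] into the function lets duality take place in the unweighted space. *)
pose phi x := (S x * w x `^ p^-1)%R.
have phip x : (phi x `^ p = S x `^ p * w x)%R.
  by rewrite /phi powRM ?powR_ge0// (powRVK (lt0r_neq0 p0) (w0 x)).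
rewrite -/(S _); under eq_integral do rewrite -phip.
have q1 : (1 < p / r)%R by rewrite ltr_pdivlMr ?mul1r//; lra.
have q'1 := conj_exp_gt1 q1.
apply: Lp_dual_bound => //.
- have q'0 : (0 <= conj_exp (p / r))%R by lra.
  apply: (mulr_ge0 _ (powR_ge0 _ _)); apply: (mulr_ge0 _ (ltW N0)).
  exact: (mulr_ge0 (divr_ge0 (ler0n _ 4) (ltW eta0)) q'0).
- exact: (measurable_funM mS mwp).
- by move=> x; rewrite mulr_ge0 ?powR_ge0.
(* The finiteness required by duality: the sum is at most [C] and vanishes off finitely many cubes,
   on each of which [w] is integrable. *)
- set C := (\sum_(Q <- s) c Q `^ r^-1)%R.
  apply: (@le_lt_trans _ _ (\int[leb]_x \sum_(Q <- s)
      ((C `^ p)%:E * (\1_(cube_set Q) x * w x)%:E))).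
    apply: ge0_le_integral_any => x _; first by rewrite lee_fin powR_ge0.
    rewrite phip.
    have SC : (S x <= C)%R.
      by apply: ler_sum => Q _; rewrite ler_piMr ?powR_ge0// indicE; case: (_ \in _).
    have [[Q sQ Qx]|nQ] := pselect (exists2 Q, Q \in s & cube_set Q x); last first.
      rewrite /S big1_seq ?powR0 ?gt_eqF ?mul0r//; last first.
        move=> Q /andP[_ sQ]; rewrite indicE memNset ?mulr0// => Qx.
        by apply: nQ; exists Q.
      by apply: sume_ge0 => Q _; rewrite -EFinM lee_fin !mulr_ge0 ?powR_ge0.
    rewrite (bigD1_seq Q)//= indicE mem_set// mul1r -EFinM.
    apply: (@le_trans _ _ (C `^ p * w x)%:E).
      rewrite lee_fin ler_wpM2r// ge0_ler_powR ?nnegrE ?(ltW p0)//.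
      exact: le_trans SC.
    rewrite leeDl// sume_ge0// => Q' _.
    by rewrite -EFinM lee_fin !mulr_ge0 ?powR_ge0.
  rewrite (ge0_integral_sum _ measurableT); last 2 first.
  - by move=> Q; apply: measurable_funeM; exact: mQw.
  - by move=> Q x _; rewrite -EFinM lee_fin !mulr_ge0 ?powR_ge0.
  apply: lte_sum_pinfty => Q _; rewrite (ge0_integralZl _ measurableT (mQw Q)); last 2 first.
  - by move=> x _; rewrite lee_fin mulr_ge0.
  - by rewrite lee_fin powR_ge0.
  rewrite integral_indicM lte_mul_pinfty ?lee_fin ?powR_ge0//.
  exact: weight_integral_cube.
move=> h mh h0 h1; apply: le_trans (finite_bilinear mh h0 h1).
rewrite (_ : \int[leb]_x _ = \int[leb]_x \sum_(Q <- s)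
    ((c Q `^ r^-1)%:E * (\1_(cube_set Q) x * (h x * w x `^ p^-1))%:E)); last first.
  apply: eq_integral => x _; rewrite /phi /S -mulrA mulr_suml -sumEFin.
  apply: eq_bigr => Q _; rewrite -EFinM; congr _%:E; ring.
rewrite (ge0_integral_sum _ measurableT); last 2 first.
- by move=> Q; apply: measurable_funeM; exact: mhwp.
- by move=> Q x _; rewrite -EFinM lee_fin !mulr_ge0 ?powR_ge0.
apply: lee_sum => Q _; rewrite (ge0_integralZl _ measurableT (mhwp h mh Q)); last 2 first.
- by move=> x _; rewrite lee_fin !mulr_ge0 ?powR_ge0.
- by rewrite lee_fin powR_ge0.
by rewrite integral_indicM.
Qed.

End finite_family.

(** * From finite lists to the whole sparse family *)

Section sparse_operator.
Variables (R : realType) (n : nat).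
Local Notation E := (Rn R n).
Local Notation leb := (lebesgue R n).
Local Notation cubeT := (cube R n).
Local Open Scope ereal_scope.

(** The index set [P] allows for a finite [S]. The enumeration turns the sum over [S] into a series,
    to which monotone convergence applies. *)
Lemma countable_injective_enum (S : set cubeT) : countable S ->
  exists (e : nat -> cubeT) (P : set nat), set_inj P e /\ e @` P = S.
Proof.
move=> /countable_injP[j jinj].
pose Q0 : cubeT := (0%R, PosNum (@ltr01 R)).
pose e i := xget Q0 [set Q | S Q /\ j Q = i].
have eP Q : S Q -> S (e (j Q)) /\ j (e (j Q)) = j Q.
  by move=> SQ; apply: (@xgetPex _ Q0 [set Q' | S Q' /\ j Q' = j Q]); exists Q.
have ej Q : S Q -> e (j Q) = Q.
  by move=> SQ; have [S1 j1] := eP _ SQ; apply: jinj; rewrite ?inE.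
exists e, (j @` S); split.
  by move=> _ _ /set_mem[Q SQ <-] /set_mem[Q' SQ' <-]; rewrite !ej// => ->.
apply/seteqP; split => [_ [_ [Q SQ <-] <-]|Q SQ]; first by rewrite ej.
by exists (j Q); [exists Q|rewrite ej].
Qed.

Definition sparse_term (r : R) (f : E -> R) (Q : cubeT) (x : E) : \bar R :=
  average Q (fun y => (f y `^ r)%:E) `^ r^-1 * (\1_(cube_set Q) x)%:E.

Lemma sparse_term_ge0 r f Q x : 0 <= sparse_term r f Q x.
Proof. by rewrite mule_ge0 ?poweR_ge0// lee_fin. Qed.

Lemma measurable_sparse_term r f Q : measurable_fun [set: E] (sparse_term r f Q).
Proof.
apply: measurable_funeM; apply/measurable_EFinP.
by apply: measurable_indic; exact: measurable_cube.
Qed.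

Lemma sparse_op_series r f (e : nat -> cubeT) (P : set nat) x : set_inj P e ->
  sparse_op r (e @` P) f x = \sum_(i <oo | i \in P) sparse_term r f (e i) x.
Proof.
move=> einj; apply: (@esum_set_image R _ (fun Q => sparse_term r f Q x) e P) => //.
by move=> i _; exact: sparse_term_ge0.
Qed.

Lemma measurable_sparse_op r f (S : set cubeT) : countable S ->
  measurable_fun [set: E] (sparse_op r S f).
Proof.
move=> /countable_injective_enum[e [P [einj <-]]].
rewrite (_ : sparse_op _ _ _ =
  (fun x => \sum_(i <oo | i \in P) sparse_term r f (e i) x)); last first.
  by apply/funext => x; exact: sparse_op_series.
apply: (@ge0_emeasurable_sum _ _ _ _ (fun i => sparse_term r f (e i)) (mem P)).
  by move=> k x _ _; exact: sparse_term_ge0.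
by move=> k _; exact: measurable_sparse_term.
Qed.

Lemma poweR_le (p : R) (x y : \bar R) : (0 <= p)%R -> 0 <= x -> x <= y ->
  x `^ p <= y `^ p.
Proof.
move=> p0 x0 xy; apply: gt0_ler_poweR => //; rewrite in_itv/= leey andbT//.
exact: le_trans xy.
Qed.

Lemma poweRK (p : R) (x : \bar R) : p != 0%R -> 0 <= x -> (x `^ p) `^ p^-1 = x.
Proof. by move=> p0 x0; rewrite -poweRrM mulfV// poweRe1. Qed.

Lemma integral_sparse_op_le (r p : R) (f w : E -> R) (S : set cubeT) (M : \bar R) :
  (0 < p)%R -> measurable_fun [set: E] w -> (forall x, (0 <= w x)%R) -> countable S ->
  (forall s : seq cubeT, uniq s -> (forall Q, Q \in s -> S Q) ->
    \int[leb]_x ((\sum_(Q <- s) sparse_term r f Q x) `^ p * (w x)%:E) <= M) ->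
  \int[leb]_x (`|sparse_op r S f x| `^ p * (w x)%:E) <= M.
Proof.
move=> p0 mw w0 cS finM.
have [e [P [einj eP]]] := countable_injective_enum cS.
pose sn k := [seq e i | i <- index_iota 0 k & i \in P].
pose T k x := \sum_(0 <= i < k | i \in P) sparse_term r f (e i) x.
have TE k x : T k x = \sum_(Q <- sn k) sparse_term r f Q x.
  by rewrite /T /sn big_map big_filter.
have T0 k x : 0 <= T k x by apply: sume_ge0 => i _; exact: sparse_term_ge0.
have Tnd x : nondecreasing_seq (T ^~ x).
  by apply: ereal_nondecreasing_series => i _ _; exact: sparse_term_ge0.
pose g k x := T k x `^ p * (w x)%:E.
have g0 k x : 0 <= g k x by rewrite mule_ge0 ?poweR_ge0// lee_fin.
have mg k : measurable_fun [set: E] (g k).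
  apply: emeasurable_funM; last exact/measurable_EFinP.
  apply: (measurableT_comp (measurable_poweR _)).
  rewrite (_ : T k = (fun x => \sum_(Q <- sn k) sparse_term r f Q x)); last first.
    by apply/funext => x; exact: TE.
  by apply: emeasurable_sum => Q; exact: measurable_sparse_term.
have gnd x : nondecreasing_seq (g ^~ x).
  move=> k l kl; apply: lee_wpmul2r; first by rewrite lee_fin.
  by apply: poweR_le; [exact: ltW|exact: T0|exact: Tnd].
have intg : \int[leb]_x limn (g ^~ x) <= M.
  have := cvg_monotone_convergence (mu := leb) measurableT mg (fun k x _ => g0 k x) (fun x _ => gnd x).
  move=> /cvg_lim <-//; apply: lime_le.
    apply: ereal_nondecreasing_is_cvgn => k l kl.
    by apply: ge0_le_integral_any => x _; [exact: g0|exact: gnd].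
  apply: nearW => k; under eq_integral do rewrite /g TE.
  apply: finM.
    rewrite /sn map_inj_in_uniq ?filter_uniq ?iota_uniq// => i l.
    rewrite !mem_filter => /andP[iP _] /andP[lP _]; exact: einj.
  by move=> _ /mapP[i + ->]; rewrite mem_filter => /andP[iP _]; rewrite -eP; exists i => //; exact: set_mem.
apply: le_trans intg; apply: ge0_le_integral_any => x _.
  by rewrite mule_ge0 ?poweR_ge0// lee_fin.
have Tle : sparse_op r S f x = limn (T ^~ x).
  by rewrite -eP sparse_op_series.
rewrite Tle gee0_abs; last first.
  apply: lime_ge; first exact: ereal_nondecreasing_is_cvgn.
  by apply: nearW => k; exact: T0.
set L := limn (g ^~ x).
have gL k : g k x <= L.
  have -> : L = ereal_sup (range (g ^~ x)).
    by apply/cvg_lim => //; exact/ereal_nondecreasing_cvgn/gnd.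
  by apply: ereal_sup_ubound; exists k.
have L0 : 0 <= L by apply: le_trans (gL 0%N).
(* To compare the power of the limit with the limit [L] of the powers, the inequality is solved for
   the partial sum, [T k x <= (L / w x)^(1/p)], before passing to the limit. This needs
   [w x > 0]. *)
have [wx0|wn0] := eqVneq (w x) 0%R; first by rewrite wx0 mule0.
have wp : (0 < w x)%R by rewrite lt_def wn0 w0.
rewrite -lee_pdivlMr//.
have LV0 : 0 <= L * (w x)^-1%:E by rewrite mule_ge0// lee_fin invr_ge0.
have pV0 : (p^-1 != 0)%R by rewrite invr_eq0 gt_eqF.
rewrite -[leRHS](poweRK pV0 LV0) invrK.
apply: poweR_le; first exact: ltW.
  apply: lime_ge; first exact: ereal_nondecreasing_is_cvgn.
  by apply: nearW => k; exact: T0.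
apply: lime_le; first exact: ereal_nondecreasing_is_cvgn.
apply: nearW => k.
rewrite -[leLHS](poweRK (lt0r_neq0 p0) (T0 k x)).
apply: poweR_le; [by rewrite invr_ge0 ltW|by rewrite poweR_ge0|].
by rewrite lee_pdivlMr//; exact: gL.
Qed.

End sparse_operator.

(** * Degenerate cubes and infinite quantities *)

Section sparse_bound.
Variables (R : realType) (n : nat) (r p eta : R).
Local Notation E := (Rn R n).
Local Notation leb := (lebesgue R n).
Local Notation cubeT := (cube R n).
Variables (w f : E -> R) (A : R -> R) (D S : set cubeT).
Let Ap := fun t : R => A (t `^ p^-1).
Hypotheses (r1 : 1 < r) (rp : r < p) (eta0 : 0 < eta) (ww : weight w).
Hypotheses (dD : dyadic_lattice D) (SD : S `<=` D) (sS : sparse eta S).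
Hypotheses (pA : proper_young A) (yB : young (complementary A)).
Hypotheses (mf : measurable_fun [set: E] f) (f0 : forall x, 0 <= f x).
Local Open Scope ereal_scope.

Let p0 : (0 < p)%R. Proof. by have hr1 := r1; have hrp := rp; lra. Qed.
Let r0 : (0 < r)%R. Proof. by have hr1 := r1; lra. Qed.

Let mfk (k : R) : measurable_fun [set: E] (fun x => (f x `^ k)%:E).
Proof. exact/measurable_EFinP/measurable_fun_powR. Qed.

Let Y := \int[leb]_x ((f x `^ p)%:E * maximal Ap w x).

(* The other cubes do not contribute to the left-hand side: a vanishing average
   kills the term, and a vanishing Luxemburg norm forces [w = 0] a.e. on [Q]. *)
Definition active : set cubeT := [set Q |
  average Q (fun y => (f y `^ r)%:E) != 0 /\ luxemburg Ap w Q != 0].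

Let luxemburg_mul_le Q :
  luxemburg Ap w Q * \int[leb]_(x in cube_set Q) (f x `^ p)%:E <= Y.
Proof.
have mQ := measurable_cube Q.
have mfp : measurable_fun (cube_set Q : set E) (fun x => (f x `^ p)%:E).
  exact/measurable_funTS/mfk.
rewrite -(ge0_integralZl _ mQ mfp); last 2 first.
- by move=> x _; rewrite lee_fin powR_ge0.
- exact: luxemburg_ge0.
have M0 x : 0 <= maximal Ap w x by exact: maximal_ge0.
rewrite integral_mkcond; apply: ge0_le_integral_any => x _.
  by apply: erestrict_ge0 => y _; rewrite mule_ge0 ?luxemburg_ge0// lee_fin powR_ge0.
rewrite /patch; case: ifPn => [|_]; last by rewrite mule_ge0// lee_fin powR_ge0.
rewrite inE muleC => Qx; apply: lee_wpmul2l; first by rewrite lee_fin powR_ge0.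
exact: luxemburg_le_maximal.
Qed.

Let integral_pow_gt0 Q : average Q (fun y => (f y `^ r)%:E) != 0 ->
  0 < \int[leb]_(x in cube_set Q) (f x `^ p)%:E.
Proof.
move=> avn0; have mQ := measurable_cube Q.
rewrite lt_def integral_ge0 ?andbT//; last by move=> x _; rewrite lee_fin powR_ge0.
apply: contra avn0 => /eqP I0.
have absE (k : R) : \int[leb]_(x in cube_set Q) `|(f x `^ k)%:E| =
    \int[leb]_(x in cube_set Q) (f x `^ k)%:E.
  by apply: eq_integral => x _; rewrite gee0_abs// lee_fin powR_ge0.
rewrite -absE in I0.
have mk (k : R) : measurable_fun (cube_set Q : set E) (fun x => (f x `^ k)%:E).
  exact/measurable_funTS/mfk.
have /(ae_eq_integral_abs leb mQ (mk p)) fae := I0.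
have : ae_eq leb (cube_set Q) (fun x => (f x `^ r)%:E) (cst 0).
  apply: filterS fae => x /= h /h [/powR_eq0_eq0 ->].
  by rewrite powR0 ?gt_eqF.
by move=> /(ae_eq_integral_abs leb mQ (mk r)); rewrite absE /average => ->; rewrite mule0.
Qed.

(** For an active cube, the Luxemburg norm of [w] and the integral of [f^p] over [Q] are positive
    with product at most [Y]; so [Y] is positive, and its finiteness makes both finite. The bound
    [f^r <= 1 + f^p] then controls the average. *)
Let active_finite Q : Y < +oo -> active Q ->
  [/\ average Q (fun y => (f y `^ r)%:E) \is a fin_num,
      luxemburg Ap w Q \is a fin_num & 0 < Y].
Proof.
move=> Yoo [avn0 luxn0]; have mQ := measurable_cube Q.
have I0 := integral_pow_gt0 avn0.
have a0 : 0 < luxemburg Ap w Q by rewrite lt_def luxn0 luxemburg_ge0.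
have aIY := luxemburg_mul_le Q.
have aIoo := le_lt_trans aIY Yoo.
set I := \int[leb]_(x in cube_set Q) (f x `^ p)%:E in I0 aIY aIoo.
have Ioo : I < +oo.
  by rewrite ltey; apply/eqP => IE; move: aIoo; rewrite IE gt0_muley.
split.
- have frp x : (f x `^ r <= 1 + f x `^ p)%R.
    have [f1|f1] := leP (f x) 1%R.
      have : (f x `^ r <= 1 `^ r)%R by rewrite ge0_ler_powR ?nnegrE ?(ltW r0).
      by rewrite powR1; have := powR_ge0 (f x) p; lra.
    have := ler_powR (ltW f1) (ltW rp); lra.
  rewrite /average ge0_fin_numE; last first.
    rewrite mule_ge0 ?lee_fin ?invr_ge0 ?fine_ge0//.
    by apply: integral_ge0 => x _; rewrite lee_fin powR_ge0.
  apply: lte_mul_pinfty; rewrite ?lee_fin ?invr_ge0 ?fine_ge0//.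
  apply: (@le_lt_trans _ _ (\int[leb]_(x in cube_set Q) (1%:E + (f x `^ p)%:E))).
    apply: ge0_le_integral_any => x _; first by rewrite lee_fin powR_ge0.
    by rewrite -EFinD lee_fin.
  rewrite ge0_integralD//; last 2 first.
  - by move=> x _; rewrite lee_fin powR_ge0.
  - exact/measurable_funTS/mfk.
  by rewrite integral_cst// lebesgue_cube lte_add_pinfty// ltry.
- rewrite ge0_fin_numE ?luxemburg_ge0// ltey; apply/eqP => aE.
  by move: aIoo; rewrite aE gt0_mulye.
- by apply: lt_le_trans aIY; rewrite mule_gt0.
Qed.

Let countable_S : countable S.
Proof. by apply: sub_countable (dyadic_lattice_countable dD); exact: subset_card_le. Qed.

Let sparse_op_active_ae : {ae leb, forall x,
  `|sparse_op r S f x| `^ p * (w x)%:E <=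
  `|sparse_op r (S `&` active) f x| `^ p * (w x)%:E}.
Proof.
have [w0 mw _] := ww.
have [e [P [einj eP]]] := countable_injective_enum countable_S.
(* Each cube has its own exceptional null set; countability of [S] provides a single one for all
   cubes. *)
have : \forall x \ae leb, forall i,
    luxemburg Ap w (e i) = 0 -> cube_set (e i) x -> w x = 0%R.
  apply: ae_foralln => i.
  have [lux0|luxn0] := pselect (luxemburg Ap w (e i) = 0).
    have := luxemburg_eq0_ae pA p0 mw w0 lux0.
    by apply: filterS => x h _; exact: h.
  exact: aeW.
apply: filterS => x hx.
have [wx0|wn0] := eqVneq (w x) 0%R; first by rewrite wx0 !mule0.
have T0 S' : 0 <= sparse_op r S' f x.
  by apply: esum_ge0 => Q _; exact: sparse_term_ge0.
rewrite !gee0_abs//; apply: lee_wpmul2r; first by rewrite lee_fin.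
apply: poweR_le => //; first exact: ltW.
rewrite /sparse_op esum_mkcondr; apply: le_esum => Q SQ.
case: ifPn => //; rewrite notin_setE => nact.
have [Qx|nQx] := pselect (cube_set Q x); last by rewrite indicE memNset// mule0.
have luxn0 : luxemburg Ap w Q != 0.
  apply/eqP => lux0; move: SQ; rewrite -eP => -[i _ eiQ].
  by move/eqP: wn0; apply; apply: (hx i); rewrite eiQ.
have /eqP -> : average Q (fun y => (f y `^ r)%:E) == 0.
  by apply/negPn/negP => avn0; apply: nact.
by rewrite poweR0r ?mul0e// invr_eq0 gt_eqF.
Qed.

Lemma sparse_op_Lp_bound :
  Lp_norm p (EFin \o w) (sparse_op r S f) <=
  (4 / eta * conj_exp (p / r))%:E * maximal_norm n (complementary A) (conj_exp p) *
  Lp_norm p (maximal Ap w) (EFin \o f).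
Proof.
have hr1 := r1; have hrp := rp.
have p1 : (1 < p)%R by lra.
have q1 : (1 < p / r)%R by rewrite ltr_pdivlMr ?mul1r.
have q'1 := conj_exp_gt1 q1; have p'1 := conj_exp_gt1 p1.
have [w0 mw _] := ww.
set K := (4 / eta * conj_exp (p / r))%R.
have K0 : (0 < K)%R.
  by apply: mulr_gt0; [exact: divr_gt0|exact: lt_trans q'1].
set NN := maximal_norm _ _ _.
have NN0 : 0 < NN by apply: maximal_norm_gt0 => //; exact: lt_trans p'1.
have -> : Lp_norm p (maximal Ap w) (EFin \o f) = Y `^ p^-1.
  have YE : (fun x => `|(EFin \o f) x| `^ p * maximal Ap w x) =
      (fun x => (f x `^ p)%:E * maximal Ap w x).
    by apply/funext => x /=; rewrite ger0_norm.
  by rewrite /Lp_norm YE.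
have M0 x : 0 <= maximal Ap w x by exact: maximal_ge0.
have Y0 : 0 <= Y.
  by apply: integral_ge0 => x _; rewrite mule_ge0// lee_fin powR_ge0.
have KN0 : 0 < K%:E * NN by rewrite mule_gt0// lte_fin.
set B := K%:E * NN * Y `^ p^-1.
have B0 : 0 <= B by rewrite mule_ge0 ?poweR_ge0// ltW.
have pV0 : (0 < p^-1)%R by rewrite invr_gt0.
rewrite /Lp_norm -[leRHS](poweRK (lt0r_neq0 p0) B0).
apply: poweR_le; first exact: ltW.
  by apply: integral_ge0 => x _; rewrite mule_ge0 ?poweR_ge0// lee_fin.
have [Yoo|Yfin] := eqVneq Y +oo.
  rewrite /B Yoo poweRyr ?lt0r_neq0// gt0_muley// poweRyr ?lt0r_neq0//.
  by rewrite leey.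
have {}Yfin : Y < +oo by rewrite ltey.
have cSa : countable (S `&` active).
  by apply: sub_countable countable_S; apply: subset_card_le; exact: subIsetl.
apply: (@le_trans _ _ (\int[leb]_x
    (`|sparse_op r (S `&` active) f x| `^ p * (w x)%:E))).
  have mT S' : countable S' ->
      measurable_fun [set: E] (fun x => `|sparse_op r S' f x| `^ p * (w x)%:E).
    move=> cS'; apply: emeasurable_funM; last exact/measurable_EFinP.
    apply: (measurableT_comp (measurable_poweR _)).
    by apply: measurableT_comp => //; exact: measurable_sparse_op.
  apply: ae_ge0_le_integral; first exact: measurableT.
  - by move=> x _; rewrite mule_ge0 ?poweR_ge0// lee_fin.
  - exact: (mT S countable_S).
  - by move=> x _; rewrite mule_ge0 ?poweR_ge0// lee_fin.
  - exact: (mT _ cSa).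
  - by apply: filterS sparse_op_active_ae => x h _.
apply: (integral_sparse_op_le p0 mw w0 cSa).
move=> s us sSa; have [s0|[Q0 Q0s]] : s = [::] \/ exists Q, Q \in s.
- by case: s {us sSa} => [|Q s]; [left|right; exists Q; rewrite mem_head].
- rewrite integral0_eq; first exact: poweR_ge0.
  by move=> x _; rewrite s0 big_nil poweR0r ?mul0e// (lt0r_neq0 p0).
(* An active cube in the list excludes [Y = 0], for which an infinite [NN] would give the bound
   [+oo * 0 = 0]. *)
have Ygt0 : 0 < Y by have [_ /active_finite[]] := sSa _ Q0s.
have [NNoo|NNfin] := eqVneq NN +oo.
  rewrite /B NNoo gt0_muley ?lte_fin// gt0_mulye ?poweR_gt0//.
  by rewrite poweRyr ?lt0r_neq0// leey.
have {}NNfin : NN \is a fin_num by rewrite ge0_fin_numE ?ltey// ltW.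
have YE : Y = (fine Y)%:E by rewrite fineK// ge0_fin_numE.
have NE : NN = (fine NN)%:E by rewrite fineK.
have [F [FS tF]] := sS.
pose a Q := fine (luxemburg Ap w Q).
pose c Q := fine (average Q (fun y => (f y `^ r)%:E)).
have ha Q : Q \in s -> luxemburg Ap w Q = (a Q)%:E.
  by move=> /sSa[_ /active_finite[]// _ lf _]; rewrite /a fineK.
have hc Q : Q \in s -> average Q (fun y => (f y `^ r)%:E) = (c Q)%:E.
  by move=> /sSa[_ /active_finite[]// af _ _]; rewrite /c fineK.
have hY : \int[leb]_x ((f x `^ p)%:E * maximal Ap w x) <= (fine Y)%:E by rewrite -YE.
have tFs : trivIset [set` s] F.
  by apply: sub_trivIset tF => Q /= /sSa[].
have nest P Q : P \in s -> Q \in s ->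
  [\/ cube_set P `<=` cube_set Q, cube_set Q `<=` cube_set P |
      cube_set P `&` cube_set Q = set0].
  move=> /sSa[/SD DP _] /sSa[/SD DQ _]; exact: (dyadic_lattice_nested dD).
have fe := finite_estimate r1 rp eta0 ww pA yB mf us tFs
  (fun Q sQ => FS Q (proj1 (sSa Q sQ))) nest ha hc NE hY.
rewrite (_ : B = (4 / eta * conj_exp (p / r) * fine NN * fine Y `^ p^-1)%:E); last first.
  by rewrite /B NE YE poweR_EFin -!EFinM.
rewrite poweR_EFin; apply: le_trans fe.
rewrite le_eqVlt; apply/orP; left; apply/eqP; apply: eq_integral => x _.
rewrite EFinM -poweR_EFin -sumEFin; congr (_ `^ _ * _).
by apply: eq_big_seq => Q sQ; rewrite /sparse_term hc// poweR_EFin.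
Qed.

End sparse_bound.

Theorem theorem1p12 (R : realType) (n : nat) (eta : R) :
  (0 < n)%N -> 0 < eta < 1 ->
  exists2 c : R, 0 < c &
    forall (r p : R) (w : Rn R n -> R) (D S : set (cube R n)) (A : R -> R),
      1 < r -> r < p -> weight w ->
      dyadic_lattice D -> S `<=` D -> sparse eta S ->
      proper_young A -> Bclass (conj_exp p) (complementary A) ->
      forall f : Rn R n -> R,
        measurable_fun [set: Rn R n] f -> (forall x, 0 <= f x) ->
        (Lp_norm p (EFin \o w) (sparse_op r S f) <=
         ((c * conj_exp p) `^ (r * (p - 1) / (p - r)))%:E *
         (conj_exp (p / r))%:E *
         maximal_norm n (complementary A) (conj_exp p) *
         Lp_norm p (maximal (fun t : R => A (t `^ p^-1)%R) w) (EFin \o f))%E.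
Proof.
move=> _ /andP[eta0 eta1]; have c0 : 0 < 4 / eta by exact: divr_gt0.
exists (4 / eta) => // r p w D S A r1 rp ww dD SD sS pA [yB _ _] f mf f0.
apply: le_trans (sparse_op_Lp_bound r1 rp eta0 ww dD SD sS pA yB mf f0) _.
have p1 : 1 < p by lra.
have p'1 := conj_exp_gt1 p1.
have q1 : 1 < p / r by rewrite ltr_pdivlMr ?mul1r//; lra.
have q'1 := conj_exp_gt1 q1.
apply: lee_wpmul2r; first exact: poweR_ge0.
apply: lee_wpmul2r.
  by apply: ltW; apply: maximal_norm_gt0 => //; exact: lt_trans p'1.
rewrite -EFinM lee_fin; apply: ler_wpM2r; first by apply: ltW; exact: lt_trans q'1.
(* Raising to an exponent at least 1 increases the base only if the base is at least 1; this is
   ensured by [eta < 1] and [conj_exp p > 1]. *)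
have c1 : 1 <= 4 / eta by rewrite ler_pdivlMr//; lra.
have cp : 4 / eta <= 4 / eta * conj_exp p by rewrite ler_pMr// ltW.
apply: (le_trans cp); apply: le1r_powR; first exact: le_trans c1 cp.
have pr : 0 < p - r by lra.
rewrite ler_pdivlMr// mul1r -subr_ge0.
rewrite (_ : r * (p - 1) - (p - r) = p * (r - 1)); last by ring.
by rewrite mulr_ge0//; lra.
Qed.
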